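(* Let $(M,g)$ be an $n$-dimensional semi-Riemannian manifold with $n>2$, equipped with a metric connection $\widetilde{\nabla}$, and let $a,b$ be real constants with $b\neq0$ such that $M$ is $\widetilde{\nabla}$-quasi-conformally symmetric (with respect to these constants). Suppose that the tensor field $\widetilde E$ is not covariantly constant with respect to $\widetilde{\nabla}$. Then the index of $M$ with respect to $\widetilde{\nabla}$ satisfies $$1\le i_{\widetilde{\nabla}}\le n+1.$$
   Context: A metric connection $\widetilde{\nabla}$ on $(M,g)$ is a linear connection with $\widetilde{\nabla}g=0$ (torsion is allowed). Its curvature is $\widetilde R(X,Y)Z=\widetilde{\nabla}_X\widetilde{\nabla}_YZ-\widetilde{\nabla}_Y\widetilde{\nabla}_XZ-\widetilde{\nabla}_{[X,Y]}Z$, and $\widetilde R(X,Y,Z,V)=g(\widetilde R(X,Y)Z,V)$. For an orthonormal basis $e_1,\dots,e_n$ with $\varepsilon_i=g(e_i,e_i)$, set $\widetilde S(X,Y)=\sum_i\varepsilon_i\widetilde R(e_i,X,Y,e_i)$ and $\widetilde r=\sum_i\varepsilon_i\widetilde S(e_i,e_i)$. The tensor of Einstein is $\widetilde E=\widetilde S-\frac{\widetilde r}{n}g$. The quasi-conformal curvature tensor with respect to $\widetilde{\nabla}$ (with constants $a,b$) is $$\widetilde{\mathcal C}_*(X,Y,Z,V)=a\widetilde R(X,Y,Z,V)+b\big(\widetilde S(Y,Z)g(X,V)-\widetilde S(X,Z)g(Y,V)+g(Y,Z)\widetilde S(X,V)-g(X,Z)\widetilde S(Y,V)\big)-\tfrac{\widetilde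 r}{n}\Big\{\tfrac{a}{n-1}+2b\Big\}\big(g(Y,Z)g(X,V)-g(X,Z)g(Y,V)\big).$$ $M$ is called $\widetilde{\nabla}$-quasi-conformally symmetric if $\widetilde{\nabla}\,\widetilde{\mathcal C}_*=0$. Index: a symmetric $(0,2)$ tensor field $H$ with $\widetilde{\nabla}H=0$ is called a special quadratic first integral (SQFI) with respect to $\widetilde{\nabla}$. A set $\{H_1,\dots,H_\ell\}$ of SQFI tensors is a complete set if it is linearly independent over $\mathbb R$ (with constant coefficients) and every SQFI tensor is a linear combination $c_1H_1+\cdots+c_\ell H_\ell$ with $c_1,\dots,c_\ell\in\mathbb R$. The index $i_{\widetilde{\nabla}}$ is the number $\ell$ of members of a complete set.
   Formalization: The manifold M is assumed connected, as is customary; without this the bound fails, e.g. for n+2 disjoint copies of a conformally flat manifold whose Einstein tensor is not parallel. *)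

(* Defs.v *)
From HB Require Import structures.
From mathcomp Require Import all_boot all_order all_algebra.
From mathcomp Require Import all_classical all_reals all_analysis.

Set Implicit Arguments.
Unset Strict Implicit.
Unset Printing Implicit Defensive.

Import Order.TTheory GRing.Theory Num.Theory.
Import numFieldNormedType.Exports.

Local Open Scope classical_set_scope.
Local Open Scope ring_scope.

Section SmoothOnRn.
Variables (R : realType) (n : nat).
Implicit Types (U : set 'rV[R]_n) (f g : 'rV[R]_n -> R).

Fixpoint Ck_on (k : nat) U f : Prop :=
  (forall x, U x -> {for x, continuous f}) /\
  (if k is k'.+1 then
     forall i : 'I_n,
       (forall x, U x -> derivable f x (delta_mx 0 i)) /\
       Ck_on k' U ('D_(delta_mx 0 i) f)
   else True).

Definition smooth_on U f := forall k, Ck_on k U f.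

Lemma Ck_on_eq k U f g : open U -> (forall x, U x -> f x = g x) ->
  Ck_on k U f -> Ck_on k U g.
Proof.
move=> Uo fg0; have fgn (h1 h2 : _ -> R) : (forall x, U x -> h1 x = h2 x) ->
    forall x, U x -> {near x, h1 =1 h2}.
  move=> h12 x Ux; near=> y; apply: h12; near: y.
  by apply: open_nbhs_nbhs; split.
have cg (h1 h2 : _ -> R) : (forall x, U x -> h1 x = h2 x) ->
    (forall x, U x -> {for x, continuous h1}) ->
    forall x, U x -> {for x, continuous h2}.
  move=> h12 ch x Ux; rewrite /prop_for /continuous_at -(h12 x Ux).
  apply: cvg_trans (ch x Ux); apply: (@near_eq_cvg _ _ (nbhs x)).
  exact: fgn h12 x Ux.
elim: k f g fg0 => [|k IH] f g fg.
  by move=> [cf _]; split=> //; exact: (cg f).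
move=> [cf df]; split; first exact: (cg f).
move=> i; have [dfi Ci] := df i; split.
  by move=> x Ux; apply: near_eq_derivable (dfi x Ux); exact: fgn fg _ _.
apply: IH Ci => x Ux; apply: near_eq_derive; exact: fgn fg _ _.
Unshelve. all: by end_near.
Qed.

Lemma Ck_onS k U f : Ck_on k.+1 U f -> Ck_on k U f.
Proof.
elim: k f => [|k IH] f [cf df]; split=> //.
by move=> i; have [dfi Ci] := df i; split=> //; exact: IH.
Qed.

Lemma Ck_on_cst k U (c : R) : open U -> Ck_on k U (cst c).
Proof.
have cc d : forall x, U x -> {for x, continuous (cst d : _ -> R)}.
  by move=> x _; apply: cvg_cst; exact: nbhs_filter.
move=> Uo; elim: k c => [|k IH] c; split=> //; try exact: cc.
move=> i; split; first by move=> x _; exact: derivable_cst.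
by apply: (Ck_on_eq Uo _ (IH 0)) => x _; rewrite derive_cst.
Qed.

Lemma Ck_onD k U f g : open U -> Ck_on k U f -> Ck_on k U g ->
  Ck_on k U (fun x => f x + g x).
Proof.
move=> Uo; elim: k f g => [|k IH] f g [cf df] [cg dg].
  by split=> // x Ux; exact: continuousD (cf x Ux) (cg x Ux).
split; first by move=> x Ux; exact: continuousD (cf x Ux) (cg x Ux).
move=> i; have [dfi Cf] := df i; have [dgi Cg] := dg i; split.
  by move=> x Ux; apply: derivableD; [exact: dfi|exact: dgi].
apply: (Ck_on_eq Uo _ (IH _ _ Cf Cg)) => x Ux.
by symmetry; apply: deriveD; [exact: dfi|exact: dgi].
Qed.

Lemma Ck_onM k U f g : open U -> Ck_on k U f -> Ck_on k U g ->
  Ck_on k U (fun x => f x * g x).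
Proof.
move=> Uo; elim: k f g => [|k IH] f g Hf Hg; have [[cf df] [cg dg]] := (Hf, Hg).
  by split=> // x Ux; exact: continuousM (cf x Ux) (cg x Ux).
split; first by move=> x Ux; exact: continuousM (cf x Ux) (cg x Ux).
move=> i; have [dfi Cf] := df i; have [dgi Cg] := dg i; split.
  by move=> x Ux; apply: derivableM; [exact: dfi|exact: dgi].
apply: (Ck_on_eq Uo _ (Ck_onD Uo (IH _ _ (Ck_onS Hf) Cg)
                               (IH _ _ (Ck_onS Hg) Cf))) => x Ux.
by symmetry; apply: deriveM; [exact: dfi|exact: dgi].
Qed.

End SmoothOnRn.

(* Only one smooth atlas is recorded, not the maximal one it generates: both
   determine the same algebra of smooth functions, from which everything below
   is built.  Connectedness is not part of the structure. *)
Record smoothManifold (R : realType) (n : nat) := SmoothManifold {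
  carrier :> topologicalType;
  carrier_hausdorff : hausdorff_space carrier;
  carrier_second_countable : @second_countable carrier;
  chart_index : Type;
  chart_dom : chart_index -> set carrier;
  chart : chart_index -> carrier -> 'rV[R]_n;
  chart_inv : chart_index -> 'rV[R]_n -> carrier;
  chart_cover : forall p, exists i, chart_dom i p;
  open_chart_dom : forall i, open (chart_dom i);
  open_chart_codom : forall i, open (chart i @` chart_dom i);
  chartK : forall i p, chart_dom i p -> chart_inv i (chart i p) = p;
  chart_continuous : forall i p, chart_dom i p -> {for p, continuous (chart i)};
  chart_inv_continuous : forall i u, (chart i @` chart_dom i) u ->
    {for u, continuous (chart_inv i)};
  chart_transition : forall i j (k : 'I_n),
    smooth_on (chart i @` (chart_dom i `&` chart_dom j))
      (fun u => chart j (chart_inv i u) 0 k)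
}.

Arguments chart_index {R n} s.
Arguments chart_dom {R n s} i.
Arguments chart {R n s} i p.
Arguments chart_inv {R n s} i u.
Arguments chart_cover {R n} s p.
Arguments open_chart_dom {R n} s i.
Arguments open_chart_codom {R n} s i.
Arguments chartK {R n s} i p.
Arguments chart_continuous {R n s} i p.
Arguments chart_inv_continuous {R n s} i u.
Arguments chart_transition {R n} s i j k.

Section SmoothFunctions.
Variables (R : realType) (n : nat) (M : smoothManifold R n).

Definition smooth_fun (f : M -> R) : Prop :=
  forall i, smooth_on (chart (s:=M) i @` chart_dom i) (f \o chart_inv i).

Definition smooth : {pred M -> R} := [pred f | `[< smooth_fun f >]].

Fact smooth_subring_closed : subring_closed smooth.
Proof.
have sN f g : f \in smooth -> g \in smooth -> f - g \in smooth.
  move=> /asboolP sf /asboolP sg; apply/asboolP => i k.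
  have Uo := open_chart_codom M i.
  have C1 := Ck_on_cst k (-1) Uo.
  apply: (Ck_on_eq Uo _ (Ck_onD Uo (sf i k) (Ck_onM Uo C1 (sg i k)))) => x _ /=.
  by rewrite mulN1r.
split=> //.
  by apply/asboolP => i k; apply: (Ck_on_cst k 1); exact: open_chart_codom.
move=> f g /asboolP sf /asboolP sg; apply/asboolP => i k.
have Uo := open_chart_codom M i.
exact: Ck_onM (sf i k) (sg i k).
Qed.

Fact smooth_scaler_closed : scaler_closed smooth.
Proof.
move=> c f /asboolP sf; apply/asboolP => i k.
have Uo := open_chart_codom M i.
exact: Ck_onM (Ck_on_cst k c Uo) (sf i k).
Qed.

HB.instance Definition _ := GRing.isSubringClosed.Build (M -> R) smooth
  smooth_subring_closed.
HB.instance Definition _ := GRing.isScaleClosed.Build R (M -> R) smooth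
  smooth_scaler_closed.

Record Cinf := MkCinf { Cinf_fun :> M -> R; _ : Cinf_fun \in smooth }.

HB.instance Definition _ := [isSub for Cinf_fun].
HB.instance Definition _ := [Choice of Cinf by <:].
HB.instance Definition _ := GRing.SubChoice_isSubComPzRing.Build (M -> R) smooth Cinf
  (subringClosedP _).
HB.instance Definition _ := [SubZmodule_isSubLmodule of Cinf by <:].

Definition is_derivation (X : Cinf -> Cinf) : Prop :=
  (forall (c : R) (f g : Cinf), X (c *: f + g) = c *: X f + X g) /\
  (forall f g : Cinf, X (f * g) = X f * g + f * X g).

(* [Cinf^o] makes [Cinf -> Cinf^o], hence the type of vector fields, a module
   over the ring of smooth functions. *)
Definition derivation : {pred Cinf -> Cinf^o} :=
  [pred X : Cinf -> Cinf^o | `[< is_derivation X >]].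

Lemma Cinf_eqP (f g : Cinf) : (forall p, f p = g p) -> f = g.
Proof. by move=> fg; apply: val_inj; apply/funext. Qed.

Lemma Cinf_scalerAr (c : R) (f g : Cinf) : f * (c *: g) = c *: (f * g).
Proof. by apply: Cinf_eqP => p; exact: mulrCA. Qed.

Fact derivation_submod_closed : submod_closed derivation.
Proof.
split.
  have E (f : Cinf) : (0 : Cinf -> Cinf^o) f = 0 by [].
  apply/asboolP; split=> [c f g|f g]; rewrite !E.
    by rewrite scaler0 addr0.
  by rewrite mul0r mulr0 addr0.
move=> h X Y /asboolP[XL XM] /asboolP[YL YM].
have E (f : Cinf) : (h *: X + Y) f = h * X f + Y f by [].
apply/asboolP; split=> [c f g|f g]; rewrite !E.
  rewrite XL YL scalerDr mulrDr -!Cinf_scalerAr -!addrA; congr +%R.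
  by rewrite addrCA.
rewrite XM YM !(mulrDl, mulrDr) !mulrA (mulrC h f) -!addrA; congr +%R.
by rewrite addrCA.
Qed.

HB.instance Definition _ := GRing.isSubmodClosed.Build Cinf (Cinf -> Cinf^o)
  derivation derivation_submod_closed.

Record vfield := MkVField {
  vfield_fun :> Cinf -> Cinf^o;
  _ : vfield_fun \in derivation
}.

HB.instance Definition _ := [isSub for vfield_fun].
HB.instance Definition _ := [Choice of vfield by <:].
HB.instance Definition _ := GRing.SubChoice_isSubZmodule.Build (Cinf -> Cinf^o)
  derivation vfield (zmodClosedP _).
HB.instance Definition _ := [SubZmodule_isSubLmodule of vfield by <:].

Lemma vfield_derivation (X : vfield) : is_derivation X.
Proof. by apply/asboolP; exact: valP X. Qed.

Fact bracket_subproof (X Y : vfield) :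
  (fun f => X (Y f) - Y (X f)) \in derivation.
Proof.
have [XL XM] := vfield_derivation X; have [YL YM] := vfield_derivation Y.
have XD f g : X (f + g) = X f + X g by rewrite -[f in LHS]scale1r XL scale1r.
have YD f g : Y (f + g) = Y f + Y g by rewrite -[f in LHS]scale1r YL scale1r.
apply/asboolP; split=> [c f g|f g].
  by rewrite YL XL XL YL scalerBr opprD addrACA.
rewrite YM XM XD YD !XM !YM mulrBl mulrBr.
have aux (V : zmodType) (a b c d e h : V) :
    a + b + (c + d) - (e + c + (b + h)) = a - e + (d - h).
  rewrite (addrC c d) addrACA (addrC b h) [e + c + _]addrACA (addrC c b).
  by rewrite opprD [LHS]addrACA subrr addr0 opprD addrACA.
exact: aux.
Qed.

Definition bracket (X Y : vfield) : vfield := MkVField (bracket_subproof X Y).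

Record tensor02 := Tensor02 {
  tensor02_fun :> vfield -> vfield -> Cinf;
  tensor02_linearl : forall f X Y Z,
    tensor02_fun (f *: X + Y) Z = f * tensor02_fun X Z + tensor02_fun Y Z;
  tensor02_linearr : forall f X Y Z,
    tensor02_fun X (f *: Y + Z) = f * tensor02_fun X Y + tensor02_fun X Z
}.

Definition symmetric02 (H : tensor02) := forall X Y, H X Y = H Y X.

(* [X] vanishes at [p] as a tangent vector when [(X f) p = 0] for every smooth
   function [f].  Constancy of the signature of the metric is not required
   separately: it follows from nondegeneracy when [M] is connected. *)
Record semiRiemannianMetric := SemiRiemannianMetric {
  metric_tensor :> tensor02;
  metric_sym : symmetric02 metric_tensor;
  metric_nondegenerate : forall (p : M) (X : vfield),
    (forall Y, metric_tensor X Y p = 0) -> forall f, X f p = 0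
}.

Record linearConnection := LinearConnection {
  connection_fun :> vfield -> vfield -> vfield;
  connection_linearl : forall f X Y Z,
    connection_fun (f *: X + Y) Z = f *: connection_fun X Z + connection_fun Y Z;
  connection_additiver : forall X Y Z,
    connection_fun X (Y + Z) = connection_fun X Y + connection_fun X Z;
  connection_leibniz : forall f X Y,
    connection_fun X (f *: Y) = X f *: Y + f *: connection_fun X Y
}.

Section Geometry.
Variables (g : semiRiemannianMetric) (D : linearConnection) (a b : R).
Implicit Types (X Y Z U V W : vfield).

Definition cov_deriv2 (T : vfield -> vfield -> Cinf) U X Y : Cinf :=
  U (T X Y) - T (D U X) Y - T X (D U Y).

Definition cov_deriv4 (T : vfield -> vfield -> vfield -> vfield -> Cinf)
    U X Y Z V : Cinf :=
  U (T X Y Z V) - T (D U X) Y Z V - T X (D U Y) Z V - T X Y (D U Z) V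
  - T X Y Z (D U V).

Definition parallel2 T := forall U X Y, cov_deriv2 T U X Y = 0.

Definition parallel4 T := forall U X Y Z V, cov_deriv4 T U X Y Z V = 0.

Definition metric_connection := parallel2 g.

Definition curvature X Y Z : vfield :=
  D X (D Y Z) - D Y (D X Z) - D (bracket X Y) Z.

Definition Rm X Y Z V : Cinf := g (curvature X Y Z) V.

(* Tangent vectors at [p] are represented by global vector fields through their
   values at [p].  Orthonormality of [n] vectors makes them a basis of the
   [n]-dimensional tangent space. *)
Definition orthonormal_at (p : M) (e : 'I_n -> vfield) : Prop :=
  forall i j, if i == j then `|g (e i) (e i) p| = 1 else g (e i) (e j) p = 0.

Definition orthonormal_basis (p : M) : 'I_n -> vfield :=
  xget (fun=> 0) [set e | orthonormal_at p e].

(* The trace does not depend on the chosen orthonormal basis and is a smooth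
   function when [T] is a tensor field, so that the default value [0] of
   [insubd] plays no role. *)
Definition trace_g (T : vfield -> vfield -> Cinf) : Cinf :=
  insubd (0 : Cinf) (fun p : M => let e := orthonormal_basis p in
    \sum_(i < n) g (e i) (e i) p * T (e i) (e i) p).

Definition ricci X Y : Cinf := trace_g (fun U V => Rm U X Y V).

Definition scalar_curvature : Cinf := trace_g ricci.

Definition einstein_tensor X Y : Cinf :=
  ricci X Y - n%:R^-1 *: (scalar_curvature * g X Y).

Definition quasi_conformal X Y Z V : Cinf :=
  a *: Rm X Y Z V
  + b *: (ricci Y Z * g X V - ricci X Z * g Y V
          + g Y Z * ricci X V - g X Z * ricci Y V)
  - (n%:R^-1 * (a / (n%:R - 1) + 2 * b)) *:
      (scalar_curvature * (g Y Z * g X V - g X Z * g Y V)).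

Definition quasi_conformally_symmetric := parallel4 quasi_conformal.

End Geometry.

Definition SQFI (D : linearConnection) (H : tensor02) : Prop :=
  symmetric02 H /\ parallel2 D H.

Definition complete_SQFI_set (D : linearConnection) (l : nat)
    (H : 'I_l -> tensor02) : Prop :=
  [/\ forall i, SQFI D (H i),
      forall c : 'I_l -> R,
        (forall X Y, \sum_(i < l) c i *: H i X Y = 0) -> forall i, c i = 0 &
      forall K, SQFI D K -> exists c : 'I_l -> R,
        forall X Y, K X Y = \sum_(i < l) c i *: H i X Y].

Definition is_index (D : linearConnection) (l : nat) : Prop :=
  exists H : 'I_l -> tensor02, complete_SQFI_set D H.

End SmoothFunctions.

(* Main.v *)
Require Import Defs.
From HB Require Import structures.
From mathcomp Require Import all_boot all_order all_algebra.
From mathcomp Require Import all_classical all_reals all_analysis.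
From mathcomp Require Import ring lra.

(** The bound is found by looking at a single point.

    Contracting the outer slots of the quasi-conformal tensor gives
    [a + (n - 2) b] times the Einstein tensor ([trace_quasi_conformal]), and
    contraction commutes with a metric connection ([trace_cov_deriv4]).  As the
    former tensor is parallel and the latter is not, [a = - (n - 2) b], and this
    is nonzero.  Parallelism of the quasi-conformal tensor then expresses the
    derivative of the curvature along a vector [U]: at each point it is the
    operator x /\ by + bx /\ y, where (x /\ y) z = g(y, z) x - g(x, z) y and [b]
    is the operator associated by the metric with a bilinear form [B], a
    combination of [g] and the derivative of the Ricci tensor.  At a point [p]
    where the derivative of the Einstein tensor does not vanish, [B] is not a
    multiple of [g], because that derivative is trace free.

    A parallel symmetric form [H] is invariant under the curvature operators, and
    under their derivatives ([cov_curvature_invariance]).  By linear algebra in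
    dimension at least 3 ([invariant_form_determined]), when [b] is not a
    homothety, a form invariant under all x /\ by + bx /\ y is determined by the
    linear form [H(v, _)] for one suitable vector [v] and by one further value
    [H(u, u')]: these are [n + 1] numbers.  On a connected manifold a parallel
    tensor that vanishes at a point vanishes identically ([parallel_zero]), so
    the [n + 1] numbers read at [p] separate the parallel symmetric forms
    ([independent_bound]).  This gives the existence of the index
    and its upper bound; the metric itself, parallel and nonzero, gives the
    lower bound.

    Since vector fields are derivations of the algebra of smooth functions,
    their local description has to be established first.  Bump functions
    ([bump_function]) and Hadamard's lemma ([hadamard]) provide, near each
    point, a frame in which a vector field has components that are values of it
    on coordinate functions ([local_frame]).  Frames turn the value of a tensor at
    a point into a matrix ([frame_expand2]), and the inverse of the Gram matrix
    of the metric shows that contractions are smooth ([trace_gE]) and how to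
    differentiate them ([trace_cov_deriv2]). *)

Set Implicit Arguments.
Unset Strict Implicit.
Unset Printing Implicit Defensive.

Import Order.TTheory GRing.Theory Num.Theory.
Import numFieldNormedType.Exports.

Local Open Scope classical_set_scope.
Local Open Scope ring_scope.

(** * Mean value theorem and chain rule for partial derivatives *)

Section CoordinateCalculus.
Variables (R : realType) (n : nat).
Implicit Types (x y u : 'rV[R]_n) (f : 'rV[R]_n -> R).

Lemma rV_norm_le x (r : R) : 0 <= r -> `|x| <= r <-> forall j, `|x 0 j| <= r.
Proof.
move=> r0; rewrite [`|x|]/Num.Def.normr /= mx_normrE; split=> [xr j|xr].
  by apply: le_trans xr; exact: (le_bigmax _ (fun ij => `|x ij.1 ij.2|) (0, j)).
by apply: bigmax_le => // -[i j] _ /=; rewrite (ord1 i).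
Qed.

Lemma rV_coord_le x j : `|x 0 j| <= `|x|.
Proof. by move/(rV_norm_le _ (normr_ge0 x)) : (lexx `|x|). Qed.

Lemma mvt_axis f x (k : 'I_n) (t : R) :
  (forall s : R, `|s| <= `|t| -> derivable f (x + s *: delta_mx 0 k) (delta_mx 0 k)) ->
  exists2 s, `|s| <= `|t| &
    f (x + t *: delta_mx 0 k) - f x =
    'D_(delta_mx 0 k) f (x + s *: delta_mx 0 k) * t.
Proof.
set e := delta_mx 0 k => df.
pose g (s : R) := f (x + s *: e).
have dg (s : R) : `|s| <= `|t| -> is_derive s (1 : R) g ('D_e f (x + s *: e)).
  move=> /df; rewrite /derivable /derive => cg.
  have E : (fun h : R => h^-1 *: ((f \o shift (x + s *: e)) (h *: e) - f (x + s *: e)))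
     = (fun h : R => h^-1 *: ((g \o shift s) (h *: (1 : R)) - g s)).
    apply/funext => h; rewrite /g /= scaler1 (scalerDl e h s).
    by rewrite addrCA.
  by split; rewrite /derivable /derive -E.
have cg (s : R) : `|s| <= `|t| -> {for s, continuous g}.
  move=> st; apply: differentiable_continuous; apply/derivable1_diffP.
  by case: (dg s st).
have g0 : g 0 = f x by rewrite /g scale0r addr0.
have [t0|t0] := leP 0 t.
  have [||s] := @MVT_segment R g (fun s => 'D_e f (x + s *: e)) 0 t t0.
  - move=> s; rewrite in_itv /= => /andP[s0 st]; apply: dg.
    by rewrite !ger0_norm// ltW.
  - apply: continuous_in_subspaceT => s; rewrite inE/= in_itv /= => /andP[s0 st].
    by apply: cg; rewrite !ger0_norm.
  rewrite in_itv /= => /andP[s0 st]; rewrite g0 subr0 => E.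
  by exists s; rewrite ?ger0_norm.
have [||s] := @MVT_segment R g (fun s => 'D_e f (x + s *: e)) t 0 (ltW t0).
- move=> s; rewrite in_itv /= => /andP[s0 st]; apply: dg.
  by rewrite !ler0_norm ?lerN2 // ltW.
- apply: continuous_in_subspaceT => s; rewrite inE/= in_itv /= => /andP[s0 st].
  by apply: cg; rewrite !ler0_norm ?lerN2 // ltW.
rewrite in_itv /= => /andP[s0 st]; rewrite g0 sub0r => E.
exists s; first by rewrite !ler0_norm ?lerN2 // ltW.
by rewrite -[LHS]opprB E mulrN opprK.
Qed.

(** Walking from [u] to [x] one coordinate at a time keeps every intermediate
    point in the box, the norm being the largest absolute value of
    a coordinate; this trades total differentiability for partial derivatives throughout. *)
Lemma mvt_coord f u (r : R) :
  (forall y, `|y - u| <= r -> forall k, derivable f y (delta_mx 0 k)) ->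
  forall x, `|x - u| <= r -> exists2 c : 'I_n -> 'rV[R]_n,
    (forall k, `|c k - u| <= `|x - u|) &
    f x - f u = \sum_k 'D_(delta_mx 0 k) f (c k) * (x 0 k - u 0 k).
Proof.
move=> df x xr.
(* [w m] has the first [m] coordinates of [x], the others are those of [u] *)
pose w m : 'rV[R]_n := \row_j (if (j < m)%N then x 0 j else u 0 j).
have wn : w n = x by apply/rowP => j; rewrite mxE ltn_ord.
have w0 : w 0%N = u by apply/rowP => j; rewrite mxE.
have wS (k : 'I_n) : w k.+1 = w k + (x 0 k - u 0 k) *: delta_mx 0 k.
  apply/rowP => j; rewrite !mxE eqxx /= ltnS leq_eqVlt.
  have [->|jk] := eqVneq j k; first by rewrite eqxx ltnn mulr1 /= addrC subrK.
  by rewrite -val_eqE in jk; rewrite (negbTE jk) /= mulr0 addr0.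
have wr (k : 'I_n) s : `|s| <= `|x 0 k - u 0 k| ->
    `|w k + s *: delta_mx 0 k - u| <= `|x - u|.
  move=> sk; apply/rV_norm_le => // j; rewrite !mxE eqxx /=.
  have := rV_coord_le (x - u) j; rewrite !mxE => xuj.
  have [->|jk] := eqVneq j k.
    rewrite ltnn mulr1 addrAC subrr add0r; apply: le_trans sk _.
    by have := rV_coord_le (x - u) k; rewrite !mxE.
  by rewrite mulr0 addr0; case: ifP => // _; rewrite subrr normr0.
have H (k : 'I_n) : exists c, `|c - u| <= `|x - u| /\
   f (w k.+1) - f (w k) = 'D_(delta_mx 0 k) f c * (x 0 k - u 0 k).
  have [s sk E] := @mvt_axis f (w k) k (x 0 k - u 0 k)
      (fun s sk => df _ (le_trans (wr k s sk) xr) k).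
  by exists (w k + s *: delta_mx 0 k); split; [exact: wr|rewrite wS].
have [c cP] := choice H.
exists c => [k|]; first by have [] := cP k.
rewrite -{1}wn -{1}w0 -(telescope_sumr (f \o w)) // big_mkord.
by apply: eq_bigr => k _; have [_] := cP k.
Qed.

(** Continuity of the partial derivatives of [f] at the one point [c x] is
    enough: by [mvt_coord] the increment of [f \o c] is a combination of
    partial derivatives of [f] at points that tend to [c x]. *)
Lemma chain_rule (V : normedModType R) (c : V -> 'rV[R]_n) f
    (U : set 'rV[R]_n) (x v : V) :
  open U -> U (c x) ->
  (forall y, U y -> forall k, derivable f y (delta_mx 0 k)) ->
  (forall k, {for c x, continuous ('D_(delta_mx 0 k) f)}) ->
  (forall k, derivable (fun y : V => c y 0 k) x v) ->
  is_derive x v (f \o c)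
    (\sum_k 'D_(delta_mx 0 k) f (c x) * 'D_v (fun y : V => c y 0 k) x).
Proof.
move=> Uo Ux df cf dc.
pose u := c x.
have [r /= r0 rU] : \forall r \near 0^'+, (ball u r `<=` U).
  by apply: open_subball.
have rU' y : `|y - u| <= r / 4 -> U y.
  move=> yr; apply: (rU (r/2)).
  - rewrite /= sub0r normrN ger0_norm; lra.
  - lra.
  - by rewrite -ball_normE /= distrC; lra.
have H (h : R) : exists p : 'I_n -> 'rV[R]_n,
    (forall k, `|p k - u| <= `|c (h *: v + x) - u|) /\
    (`|c (h *: v + x) - u| <= r / 4 -> f (c (h *: v + x)) - f u =
      \sum_k 'D_(delta_mx 0 k) f (p k) * (c (h *: v + x) 0 k - u 0 k)).
  have [hr|hr] := leP `|c (h *: v + x) - u| (r / 4).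
    by have [p p1 p2] := mvt_coord (fun y yr => df y (rU' y yr)) hr; exists p.
  by exists (fun=> u); split => // k; rewrite subrr normr0.
have {H}[p pP] := choice H.
have ck k : c (h *: v + x) 0 k @[h --> 0^'] --> u 0 k.
  have /derivable1P/derivable1_diffP/differentiable_continuous := dc k.
  rewrite /prop_for /continuous_at /= scale0r add0r => ck.
  by apply: cvg_trans ck; apply: cvg_app; exact: nbhs_dnbhs.
have cc e : 0 < e -> \forall h \near 0^', `|c (h *: v + x) - u| <= e.
  move=> e0.
  have /filter_forall : forall k, \forall h \near 0^', `|c (h *: v + x) 0 k - u 0 k| <= e.
    move=> k; have /cvgrPdist_le/(_ e e0) := ck k.
    by apply: filterS => h /=; rewrite distrC.
  apply: filterS => h hk; apply/(rV_norm_le _ (ltW e0)) => k.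
  by rewrite !mxE.
have pc k : p h k @[h --> 0^'] --> u.
  apply/cvgrPdist_le => e e0.
  apply: filterS (cc e e0) => h he; rewrite distrC.
  by have [H _] := pP h; exact: le_trans (H k) he.
suff L : h^-1 *: ((f \o c \o shift x) (h *: v) - (f \o c) x) @[h --> 0^'] -->
    \sum_k 'D_(delta_mx 0 k) f (c x) * 'D_v (fun y : V => c y 0 k) x.
  by split; [apply/cvg_ex; eexists; exact: L|exact: (cvg_lim _ L)].
have L' : \sum_k 'D_(delta_mx 0 k) f (p h k) *
    (h^-1 *: (c (h *: v + x) 0 k - u 0 k)) @[h --> 0^'] -->
    \sum_k 'D_(delta_mx 0 k) f (c x) * 'D_v (fun y : V => c y 0 k) x.
  apply: (cvg_big (op := +%R)); first exact: add_continuous.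
  move=> k _.
  apply: cvgM; last exact: dc.
  exact: continuous_cvg (cf k) (pc k).
apply: cvg_trans L'; apply: near_eq_cvg.
have r4 : 0 < r / 4 by rewrite divr_gt0.
apply: filterS (cc _ r4) => h hr /=.
have [_ /(_ hr)] := pP h; rewrite -/u => ->.
rewrite scaler_sumr; apply: eq_bigr => k _.
by rewrite -scalerAr.
Qed.

End CoordinateCalculus.

(** * Stability properties of functions of class C^k *)

Section SmoothClosure.
Variables (R : realType).

Lemma continuous_row (T : topologicalType) n (c : T -> 'rV[R]_n) x :
  (forall k, {for x, continuous (fun y => c y 0 k)}) -> {for x, continuous c}.
Proof.
move=> cc; apply/cvgrPdist_le => e e0.
have /filter_forall : forall k, \forall y \near x, `|c x 0 k - c y 0 k| <= e.
  by move=> k; have /cvgrPdist_le/(_ e e0) := cc k.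
apply: filterS => y hk; apply/(rV_norm_le _ (ltW e0)) => k.
by rewrite !mxE.
Qed.

Lemma is_derive_line (V : normedModType R) (f : V -> R) (x v : V) (df : R) :
  is_derive x v f df <-> is_derive (0 : R) (1 : R) (fun h : R => f (h *: v + x)) df.
Proof.
have E : (fun h : R => h^-1 *: ((f \o shift x) (h *: v) - f x)) =
   (fun h : R => h^-1 *: (((fun h : R => f (h *: v + x)) \o shift 0) (h *: (1 : R))
      - f (0 *: v + x))).
  by apply/funext => h /=; rewrite addr0 scale0r add0r scaler1.
split=> -[d1 d2]; split; move: d1 d2; rewrite /derivable /derive.
- by rewrite E.
- by rewrite E.
- by rewrite -E.
- by rewrite -E.
Qed.

Section OneSpace.
Variable n : nat.
Implicit Types (U V : set 'rV[R]_n) (f g : 'rV[R]_n -> R).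

Lemma Ck_on_sub k U V f : V `<=` U -> Ck_on k U f -> Ck_on k V f.
Proof.
move=> VU; elim: k f => [|k IH] f [cf df]; split=> //; try by move=> x /VU /cf.
by move=> i; have [di Ci] := df i; split; [move=> x /VU /di|exact: IH].
Qed.

(** Being C^k is a condition on the germs of [f] at the points of the set. *)
Lemma Ck_on_local k U f :
  (forall x, U x -> exists2 V, V x & Ck_on k V f) -> Ck_on k U f.
Proof.
elim: k f => [|k IH] f H; split=> //; try by move=> x /H[V Vx [cf _]]; exact: cf.
move=> i; split; first by move=> x /H[V Vx [_ /(_ i)[df _]]]; exact: df.
  by apply: IH => x /H[V Vx [_ /(_ i)[_ Ci]]]; exists V.
Qed.

Lemma Ck_on_sum k U (I : Type) (r : seq I) (F : I -> 'rV[R]_n -> R) : open U ->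
  (forall i, Ck_on k U (F i)) -> Ck_on k U (fun x => \sum_(i <- r) F i x).
Proof.
move=> Uo CF; elim: r => [|i r IH].
  by apply: Ck_on_eq (Ck_on_cst k 0 Uo) => // x _; rewrite big_nil.
by apply: Ck_on_eq (Ck_onD Uo (CF i) IH) => // x _; rewrite big_cons.
Qed.

Lemma Ck_on_prod k U (I : Type) (r : seq I) (F : I -> 'rV[R]_n -> R) : open U ->
  (forall i, Ck_on k U (F i)) -> Ck_on k U (fun x => \prod_(i <- r) F i x).
Proof.
move=> Uo CF; elim: r => [|i r IH].
  by apply: Ck_on_eq (Ck_on_cst k 1 Uo) => // x _; rewrite big_nil.
by apply: Ck_on_eq (Ck_onM Uo (CF i) IH) => // x _; rewrite big_cons.
Qed.

Lemma Ck_onV k U f : open U -> (forall x, U x -> f x != 0) ->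
  Ck_on k U f -> Ck_on k U (fun x => (f x)^-1).
Proof.
move=> Uo f0; elim: k => [|k IH] Cf.
  by case: Cf => cf _; split=> // x Ux; apply: continuousV; [exact: f0|exact: cf].
have [cf df] := Cf; split.
  by move=> x Ux; apply: continuousV; [exact: f0|exact: cf].
move=> i; have [di Ci] := df i; split.
  by move=> x Ux; apply: derivableV; [exact: f0|exact: di].
have CV := IH (Ck_onS Cf).
apply: (Ck_on_eq Uo _ (Ck_onM Uo (Ck_onM Uo (Ck_on_cst k (-1) Uo) Ci)
                                 (Ck_onM Uo CV CV))) => x Ux.
rewrite deriveV; [|exact: f0|exact: di].
by rewrite /GRing.scale /= expr2 invfM; ring.
Qed.

Lemma is_derive_coord (i j : 'I_n) (x : 'rV[R]_n) :
  is_derive x (delta_mx 0 j) (fun y : 'rV[R]_n => y 0 i) (i == j)%:R.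
Proof.
have df := differentiable_coord x 0 i.
split; first exact: diff_derivable.
have E : (fun h : R => h^-1 *: (((fun y : 'rV[R]_n => y 0 i) \o shift x)
    (h *: delta_mx 0 j) - x 0 i)) @ 0^' --> ((i == j)%:R : R).
  apply: cvg_trans (@cvg_cst _ ((i == j)%:R : R) _ _ (dnbhs_filter _)).
  apply: near_eq_cvg; apply: filterS (nbhs_dnbhs_neq (0 : R)) => h h0.
  rewrite /= !mxE eqxx /= addrK.
  by rewrite /GRing.scale /= mulKf.
exact: (cvg_lim _ E).
Qed.

Lemma Ck_on_coord k U (i : 'I_n) : open U -> Ck_on k U (fun x => x 0 i).
Proof.
move=> Uo.
case: k => [|k]; split => //; try by move=> x _; exact: coord_continuous.
move=> j; split; first by move=> x _; case: (is_derive_coord i j x).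
  apply: Ck_on_eq (Ck_on_cst k ((i == j)%:R) Uo) => // x _.
  by have /@derive_val := is_derive_coord i j x.
Qed.

(** Indexing the successive derivatives of a one-variable function by [Phi m]
    makes the statement stable under differentiation, so that the induction
    on [k] goes through with [m] varying. *)
Lemma Ck_on_comp1 k U f (Phi : nat -> R -> R) m : open U ->
  (forall m t, is_derive t (1 : R) (Phi m) (Phi m.+1 t)) ->
  Ck_on k U f -> Ck_on k U (Phi m \o f).
Proof.
move=> Uo dP.
have cP m' t : {for t, continuous (Phi m')}.
  apply: differentiable_continuous; apply/derivable1_diffP.
  by case: (dP m' t).
elim: k m => [|k IH] m Cf.
  case: Cf => cf _; split=> // x Ux.
  by apply: continuous_comp; [exact: cf|exact: cP].
have [cf df] := Cf; split.
  by move=> x Ux; apply: continuous_comp; [exact: cf|exact: cP].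
move=> i; have [di Ci] := df i.
have D x : U x -> is_derive x (delta_mx 0 i) (Phi m \o f)
    (Phi m.+1 (f x) * 'D_(delta_mx 0 i) f x).
  move=> Ux; set e := delta_mx 0 i.
  have /derivableP/is_derive_line dfl := di x Ux.
  apply/is_derive_line.
  have := @is_derive1_comp R (Phi m) (fun h : R => f (h *: e + x)) 0 _ _ (dP m _) dfl.
  by rewrite scale0r add0r.
split; first by move=> x /D[].
apply: (Ck_on_eq Uo _ (Ck_onM Uo (IH m.+1 (Ck_onS Cf)) Ci)) => x Ux.
by case: (D x Ux).
Qed.

End OneSpace.

Lemma Ck_on_comp k m n (U : set 'rV[R]_m) (V : set 'rV[R]_n)
    (f : 'rV[R]_n -> R) (c : 'rV[R]_m -> 'rV[R]_n) :
  open U -> open V -> (forall x, U x -> V (c x)) ->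
  Ck_on k V f -> (forall j, Ck_on k U (fun x => c x 0 j)) -> Ck_on k U (f \o c).
Proof.
move=> Uo Vo UV; elim: k f => [|k IH] f Cf Cc.
  case: Cf => cf _; split=> // x Ux; apply: continuous_comp; last exact/cf/UV.
  by apply: continuous_row => j; have [cc _] := Cc j; exact: cc.
have [cf df] := Cf.
have ccont x : U x -> {for x, continuous c}.
  by move=> Ux; apply: continuous_row => j; have [cc _] := Cc j; exact: cc.
split; first by move=> x Ux; apply: continuous_comp; [exact: ccont|exact/cf/UV].
move=> i.
have D x : U x -> is_derive x (delta_mx 0 i) (f \o c)
    (\sum_j 'D_(delta_mx 0 j) f (c x) * 'D_(delta_mx 0 i) (fun y => c y 0 j) x).
  move=> Ux; apply: (chain_rule Vo (UV x Ux)) => [y Vy j|j|j].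
  - by have [dj _] := df j; exact: dj.
  - by have [_] := df j; case: (k) => [|k'] [cj _]; exact/cj/UV.
  - by have [_ /(_ i)[dj _]] := Cc j; exact: dj.
split; first by move=> x /D[].
apply: (@Ck_on_eq _ _ k _ (fun x => \sum_j 'D_(delta_mx 0 j) f (c x) *
    'D_(delta_mx 0 i) (fun y => c y 0 j) x)) => [//|x /D[]//|].
apply: Ck_on_sum => // j; apply: Ck_onM => //.
  by have [_ Cj] := df j; apply: (IH _ Cj) => l; exact/Ck_onS/Cc.
by have [_ /(_ i)[]] := Cc j.
Qed.

End SmoothClosure.

(** * Smooth bump functions on R^n *)

Section Bump.
Variables (R : realType).
Implicit Types (p : {poly R}) (t : R).

(** For [p = 1] this is the classical function [exp (- 1 / t)] extended by [0].
    Allowing any polynomial in [1 / t] as a factor gives a family that is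
    closed under differentiation, which makes smoothness immediate. *)
Definition flat p t : R :=
  if 0 < t then p.[t^-1] * expR (- t^-1) else 0.

Definition flat_next p : {poly R} := 'X^2 * (p - p^`()).

(** Each monomial is dominated by its own term of the exponential series. *)
Lemma poly_expR_bounded p :
  exists2 C, 0 <= C & forall s : R, 0 <= s -> `|p.[s] * expR (- s)| <= C.
Proof.
exists (\sum_(i < size p) `|p`_i| * i`!%:R).
  by apply: sumr_ge0 => i _; rewrite mulr_ge0.
move=> s s0; rewrite horner_coef mulr_suml.
apply: le_trans (ler_norm_sum _ _ _) _; apply: ler_sum => i _.
rewrite -mulrA normrM ler_wpM2l // ger0_norm; last first.
  by rewrite mulr_ge0 ?exprn_ge0 ?expR_ge0.
rewrite expRN ler_pdivrMr ?expR_gt0 //.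
have f0 : 0 < (i : nat)`!%:R :> R by rewrite ltr0n fact_gt0.
rewrite mulrC -ler_pdivrMr //.
case: (nat_of_ord i) => [|m].
  by rewrite expr0 fact0 divr1; apply: le_trans (expR_ge1Dx _); rewrite lerDl.
by apply: le_trans (expR_ge1Dxn m s0); rewrite lerDr.
Qed.

Lemma is_derive_flat p t : is_derive t (1 : R) (flat p) (flat (flat_next p) t).
Proof.
have [t0|t0|t0] := ltrgtP t 0.
- rewrite /flat ltNge (ltW t0) /=.
  apply: (@near_eq_is_derive _ _ _ (cst 0)).
    near=> y; rewrite ltNge ltW //=; near: y.
    exact: lt_nbhsl.
- pose G (y : R) : R := p.[y^-1] * expR (- y^-1).
  apply: (@near_eq_is_derive _ _ _ G).
    near=> y; rewrite /flat ifT //; near: y; exact: lt_nbhsr.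
  have t1 : t != 0 by rewrite gt_eqF.
  have dV : is_derive t (1 : R) (fun y : R => y^-1) (- t^-2).
    have := @is_deriveV R id t 1 1 t1 (is_derive_id _ _).
    by rewrite /GRing.scale /= mulr1.
  have dp : is_derive t (1 : R) (fun y : R => p.[y^-1]) (p^`().[t^-1] * - t^-2).
    exact: (@is_derive1_comp _ (horner p) (fun y : R => y^-1)).
  have dN : is_derive t (1 : R) (fun y : R => - y^-1) (- - t^-2) by exact: is_deriveN.
  have de : is_derive t (1 : R) (fun y : R => expR (- y^-1)) (expR (- t^-1) * - - t^-2).
    exact: (@is_derive1_comp _ (@expR R) (fun y : R => - y^-1)).
  apply: is_derive_eq.
  rewrite /flat t0 /flat_next !hornerE /GRing.scale /= exprVn; ring.
- rewrite t0.
  (* the quotient at [h] is [h] times a bounded function of [h^-1]: the factor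
     ['X^2] pays for the division by [h] and leaves one power of [h] *)
  have [C C0 CP] := poly_expR_bounded ('X^2 * p).
  have L : h^-1 *: ((flat p \o shift 0) (h *: (1 : R)) - flat p 0) @[h --> (0:R)^'] --> (0 : R).
    apply/cvgrPdist_le => e e0.
    have : \forall h \near (0:R)^', `|h| <= e / (C + 1).
      apply: nbhs_dnbhs; apply: filterS (nbhsx_ballx (0 : R) (e / (C+1)) _) => [h|].
        by rewrite -ball_normE /= sub0r normrN => /ltW.
      by rewrite divr_gt0 // ltr_wpDl.
    apply: filterS => h he.
    rewrite sub0r normrN /= addr0 scaler1 {2}/flat ltxx subr0 /flat.
    case: ifP => [h0|_]; last by rewrite scaler0 normr0 ltW.
    have -> : h^-1 *: (p.[h^-1] * expR (- h^-1)) =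
        h * (('X^2 * p).[h^-1] * expR (- h^-1)).
      rewrite !hornerE /GRing.scale /=; field.
      by rewrite gt_eqF.
    rewrite normrM; apply: le_trans (ler_pM _ _ he (CP _ _)) _ => //.
      by rewrite invr_ge0 ltW.
    rewrite mulrAC ler_pdivrMr ?ltr_wpDl // ler_pM2l //.
    by rewrite lerDl.
  split; first by apply/cvg_ex; exists 0.
  rewrite {2}/flat ltxx; exact: (cvg_lim _ L).
Unshelve. all: by end_near. Qed.

Definition flat_tower m := flat (iter m flat_next 1).

Lemma is_derive_flat_tower m t :
  is_derive t (1 : R) (flat_tower m) (flat_tower m.+1 t).
Proof. exact: is_derive_flat. Qed.

Lemma flat_tower0_gt0 t : 0 < t -> 0 < flat_tower 0 t.
Proof. by move=> t0; rewrite /flat_tower /flat t0 hornerE mul1r expR_gt0. Qed.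

Lemma flat_tower0_eq0 t : t <= 0 -> flat_tower 0 t = 0.
Proof. by move=> t0; rewrite /flat_tower /flat ltNge t0. Qed.

Lemma flat_tower0_ge0 t : 0 <= flat_tower 0 t.
Proof.
by have [t0|t0] := leP t 0; [rewrite flat_tower0_eq0|apply/ltW/flat_tower0_gt0].
Qed.

(** The denominator never vanishes because [t] and [1 - t] are not both
    nonpositive. *)
Definition smooth_step t : R := 
  flat_tower 0 t * (flat_tower 0 t + flat_tower 0 (1 - t))^-1.

Lemma smooth_step_eq1 t : 1 <= t -> smooth_step t = 1.
Proof.
move=> t1; rewrite /smooth_step (@flat_tower0_eq0 (1 - t)) ?subr_le0 //.
by rewrite addr0 divff // gt_eqF // flat_tower0_gt0 // (lt_le_trans ltr01).
Qed.

Lemma smooth_step_eq0 t : t <= 0 -> smooth_step t = 0.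
Proof. by move=> t0; rewrite /smooth_step flat_tower0_eq0 // mul0r. Qed.

Lemma Ck_on_smooth_step n k (U : set 'rV[R]_n) f : open U -> Ck_on k U f ->
  Ck_on k U (smooth_step \o f).
Proof.
move=> Uo Cf.
have C1 : Ck_on k U (fun x => 1 - f x).
  apply: Ck_on_eq (Ck_onD Uo (Ck_on_cst k 1 Uo)
    (Ck_onM Uo (Ck_on_cst k (-1) Uo) Cf)) => // x _.
  by rewrite mulN1r.
have Cr := Ck_on_comp1 0 Uo is_derive_flat_tower Cf.
have C1r := Ck_on_comp1 0 Uo is_derive_flat_tower C1.
apply: Ck_onM => //; apply: Ck_onV => //; last exact: Ck_onD.
move=> x _ /=; rewrite gt_eqF //.
have [t0|t0] := ltP 0 (f x).
  by rewrite ltr_pwDl ?flat_tower0_gt0 ?flat_tower0_ge0.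
rewrite ltr_wpDl ?flat_tower0_gt0 ?flat_tower0_ge0 //.
by rewrite subr_gt0 (le_lt_trans t0).
Qed.

Lemma bump_rV n (u : 'rV[R]_n) (r : R) : 0 < r ->
  exists B : 'rV[R]_n -> R, [/\ smooth_on setT B,
    forall x, `|x - u| <= r -> B x = 1 &
    forall x, ~ `|x - u| <= 2 * r -> B x = 0].
Proof.
move=> r0.
(* at least [1] for a coordinate within [r] of [u], negative beyond [2 * r] *)
pose s (k : 'I_n) (x : 'rV[R]_n) := 2 - ((x 0 k - u 0 k) / r) ^+ 2.
exists (fun x => \prod_(k < n) smooth_step (s k x)); split.
- move=> m; apply: Ck_on_prod => [|k]; first exact: openT.
  apply: (@Ck_on_smooth_step n m setT (s k)); first exact: openT.
  have oT : open [set: 'rV[R]_n] by exact: openT.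
  have Cx : Ck_on m setT (fun x : 'rV[R]_n => (x 0 k - u 0 k)).
    exact: (Ck_onD oT (Ck_on_coord m k oT) (Ck_on_cst m (- u 0 k) oT)).
  apply: Ck_on_eq (Ck_onD oT (Ck_on_cst m 2 oT)
    (Ck_onM oT (Ck_on_cst m (- r^-2) oT) (Ck_onM oT Cx Cx))) => // x _.
  rewrite /s expr_div_n. by rewrite /= mulNr expr2 [_ ^+2 / _]mulrC.
- move=> x xu; rewrite big1 // => k _; apply: smooth_step_eq1.
  have := le_trans (rV_coord_le (x - u) k) xu; rewrite !mxE => xk.
  have : ((x 0 k - u 0 k) / r) ^+ 2 <= 1.
    rewrite -real_normK ?num_real // normrM normfV (ger0_norm (ltW r0)).
    apply: exprn_ile1; first by rewrite divr_ge0 // ltW.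
    by rewrite ler_pdivrMr // mul1r.
  rewrite /s; lra.
- move=> x xu.
  have [k xk] : exists k, 2 * r < `|x 0 k - u 0 k|.
    apply: contrapT => H; apply: xu; apply/rV_norm_le => [|k].
      by rewrite mulr_ge0 ?ltW.
    by rewrite !mxE leNgt; apply/negP => ?; apply: H; exists k.
  rewrite (bigD1 k) //= smooth_step_eq0 ?mul0r // /s.
  have : 2 <= `|(x 0 k - u 0 k) / r|.
    by rewrite normrM normfV (ger0_norm (ltW r0)) ler_pdivlMr // ltW.
  rewrite -[X in 2 - X](@real_normK _ (_ / _)) ?num_real //.
  set a := `|_|; nra.
Qed.

End Bump.

(** * Hadamard's lemma *)

Section Hadamard.
Variables (R : realType) (n : nat).
Implicit Types (u x y : 'rV[R]_n) (F : 'rV[R]_n -> R).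
Local Notation mu := (@lebesgue_measure R).

Lemma compact_box u (r : R) : compact [set y | `|y - u| <= r].
Proof.
apply: bounded_closed_compact.
  exists (`|u| + r); split; first exact: num_real.
  move=> M uM y /= yr; rewrite -(subrK u y); apply: le_trans (ler_normD _ _) _.
  by rewrite addrC (le_trans _ (ltW uM)) // lerD2l.
have -> : [set y | `|y - u| <= r] = (fun y => `|y - u|) @^-1` [set t | t <= r] by [].
apply: closed_comp; last exact: closed_le.
move=> y _; apply: continuous_comp; last exact: norm_continuous.
by apply: continuousB; [exact: cvg_id|exact: cst_continuous].
Qed.

Lemma bounded_on_box F u (r : R) : 0 <= r ->
  (forall y, `|y - u| <= r -> {for y, continuous F}) ->
  exists2 C, 0 <= C & forall y, `|y - u| <= r -> `|F y| <= C.
Proof.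
move=> r0 cF.
have [||c _ cP] := @EVT_max_rV R n (fun y => `|F y|) _ _ (@compact_box u r).
- by exists u; rewrite /= subrr normr0.
- apply: continuous_in_subspaceT => y; rewrite inE /= => yr.
  by apply: continuous_comp; [exact: cF|exact: norm_continuous].
by exists `|F c| => // y yr; apply: cP; rewrite inE.
Qed.

Lemma box_ray u x (r t : R) : `|x - u| <= r -> 0 <= t <= 1 ->
  `|u + t *: (x - u) - u| <= r.
Proof.
move=> xr /andP[t0 t1]; rewrite addrAC subrr add0r normrZ ger0_norm //.
by apply: le_trans xr; rewrite ler_piMl.
Qed.

(** The remainders in Hadamard's lemma are the integrals with [m = 0].
    Differentiating under the integral sign along a coordinate raises [m] by
    one and replaces [F] by its partial derivative, so the whole family is
    treated at once. *)
Definition ray_integral u m F x : R :=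
  \int[mu]_(t in `[0, 1]) (t ^+ m * F (u + t *: (x - u))).

Lemma ray_continuous u x (t : R) : {for t, continuous (fun t : R => u + t *: (x - u))}.
Proof.
apply: continuousD; first exact: cst_continuous.
exact: scalel_continuous.
Qed.

Lemma ray_integrable u m F x :
  (forall y, `|y - u| <= `|x - u| -> {for y, continuous F}) ->
  mu.-integrable `[0, 1] (EFin \o (fun t : R => t ^+ m * F (u + t *: (x - u)))).
Proof.
move=> cF; apply: continuous_compact_integrable; first exact: segment_compact.
apply: continuous_in_subspaceT => t; rewrite inE /= in_itv /= => t01.
have c1 : {for (t : R), continuous (fun t : R => t ^+ m)} by exact: exprn_continuous.
have c2 : {for (t : R), continuous (fun t : R => F (u + t *: (x - u)))}.
  apply: continuous_comp; first exact: ray_continuous.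
  by apply: cF; exact: box_ray.
exact: (continuousM c1 c2).
Qed.

Lemma ray_integral_derive u m F x k (r : R) : `|x - u| < r ->
  (forall y, `|y - u| < r -> {for y, continuous F}) ->
  (forall y, `|y - u| < r -> derivable F y (delta_mx 0 k)) ->
  (forall y, `|y - u| < r -> {for y, continuous ('D_(delta_mx 0 k) F)}) ->
  is_derive x (delta_mx 0 k) (ray_integral u m F)
    (ray_integral u m.+1 ('D_(delta_mx 0 k) F) x).
Proof.
set e := delta_mx 0 k => xr cF dF cdF.
(* [d] leaves room to move [x] along the axis without leaving the ball *)
pose d : R := (r - `|x - u|) / 2.
have d0 : 0 < d by rewrite divr_gt0 // subr_gt0.
pose s : R := `|x - u| + d.
have sr : s < r by rewrite /s /d; lra.
have e1 : `|e| <= 1.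
  apply/rV_norm_le => // j; rewrite !mxE eqxx /=.
  by case: eqP => _; rewrite ?normr1 ?normr0.
have hs (h : R) : h \in `]-d, d[ -> `|h *: e + x - u| <= s.
  rewrite in_itv /= => /andP[h1 h2]; rewrite -addrA addrC.
  apply: le_trans (ler_normD _ _) _; rewrite /s lerD2l normrZ.
  have hd : `|h| <= d by rewrite ler_norml !ltW.
  by apply: le_trans (ler_pM _ _ hd e1) _ => //; rewrite mulr1.
have s0 : 0 <= s by rewrite /s addr_ge0 // ltW.
have [C C0 CP] := bounded_on_box s0 (fun y ys => cdF y (le_lt_trans ys sr)).
pose f (h t : R) : R := t ^+ m * F (u + t *: (h *: e + x - u)).
have I0 : `]-d, d[%classic (0 : R) by rewrite /= in_itv /= oppr_lt0 d0.
have mI : measurable (`[0, 1]%classic : set (measurableTypeR R)) by exact: measurable_itv.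
have intf h : `]-d, d[%classic h -> mu.-integrable `[0, 1] (EFin \o f h).
  move=> /= hd; apply: (@ray_integrable u m F (h *: e + x)) => y yh.
  by apply: cF; apply: le_lt_trans sr; apply: le_trans yh _; exact: hs.
have df (h t : R) : `]-d, d[%classic h -> `[0, 1]%classic t ->
    is_derive h (1 : R) (f ^~ t)
      (t ^+ m.+1 * 'D_e F (u + t *: (h *: e + x - u))).
  move=> /= hd; rewrite in_itv /= => t01.
  set y := u + t *: (h *: e + x - u).
  have ys : `|y - u| < r.
    by apply: le_lt_trans sr; apply: box_ray => //; exact: hs.
  have /derivableP/is_derive_line dl := dF y ys.
  have dt : is_derive h (1 : R) (fun h' : R => t * (h' - h)) t.
    have := @is_deriveZ _ _ _ _ t h (1:R) _ (@is_deriveB _ _ _ _ _ h (1:R) _ _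
      (is_derive_id _ _) (is_derive_cst h h (1 : R))).
    by rewrite subr0 /GRing.scale /= mulr1.
  have := @is_derive1_comp R (fun h' : R => F (h' *: e + y)) _ h _ _ _ dt.
  rewrite subrr mulr0 => /(_ _ dl) dc.
  have := @is_deriveZ _ _ _ _ (t ^+ m) h (1:R) _ dc.
  rewrite /GRing.scale /= mulrCA mulrC exprSr => H.
  have -> : f^~ t = (t ^+ m \*: ((fun h' : R => F (h' *: e + y)) \o
       (fun h' : R => t * (h' - h)))).
    apply/funext => h'; rewrite /f /=; congr (_ * F _).
    by apply/rowP => j; rewrite /y !mxE; ring.
  exact: H.
have df1 h t : `]-d, d[%classic h -> `[0, 1]%classic t -> derivable (f ^~ t) h 1.
  by move=> hI tI; case: (df h t hI tI).
have intC : mu.-integrable `[0, 1] (EFin \o (fun _ : R => C)).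
  apply: continuous_compact_integrable; first exact: segment_compact.
  by apply: continuous_in_subspaceT => t _; exact: cst_continuous.
have partialE h t : `]-d, d[%classic h -> `[0, 1]%classic t ->
    partial1of2 f h t = t ^+ m.+1 * 'D_e F (u + t *: (h *: e + x - u)).
  by move=> hI tI; rewrite partial1of2E; case: (df h t hI tI).
have partial_ub h t : `]-d, d[%classic h -> `[0, 1]%classic t ->
    `|partial1of2 f h t| <= C.
  move=> hI tI; rewrite partialE // normrM -[leRHS]mul1r.
  move: hI tI => /= hI; rewrite in_itv /= => t01; apply: ler_pM => //.
    by have /andP[t0 t1] := t01; rewrite normrX ger0_norm // exprn_ile1.
  by apply: CP; apply: box_ray => //; exact: hs.
have C0' (t : R) : 0 <= (fun _ : R => C) t by [].
have H1 := derivable_under_integral mI I0 intf df1 C0' intC partial_ub.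
have H2 := differentiation_under_integral mI I0 intf df1 C0' intC partial_ub.
apply/is_derive_line; split; first exact: H1.
rewrite -derive1E H2; apply: eq_Rintegral => t /[!inE] tI.
by rewrite partialE // scale0r add0r.
Qed.

Lemma smooth_on_continuous (U : set 'rV[R]_n) F y : smooth_on U F -> U y ->
  {for y, continuous F}.
Proof. by move=> /(_ 0%N)[cF _] /cF. Qed.

Lemma smooth_on_derivable (U : set 'rV[R]_n) F y k : smooth_on U F -> U y ->
  derivable F y (delta_mx 0 k).
Proof. by move=> /(_ 1%N)[_ /(_ k)[dF _]] /dF. Qed.

Lemma smooth_on_derive (U : set 'rV[R]_n) F k : smooth_on U F ->
  smooth_on U ('D_(delta_mx 0 k) F).
Proof. by move=> sF j; have [_ /(_ k)[]] := sF j.+1. Qed.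

Lemma ball_normP u x (r : R) : ball u r x <-> `|x - u| < r.
Proof. by rewrite -ball_normE /= distrC. Qed.

(** A function with bounded partial derivatives is Lipschitz on a box. *)
Lemma continuous_bounded_partials F x (d C : R) : 0 < d ->
  (forall y, `|y - x| <= d -> forall k, derivable F y (delta_mx 0 k)) ->
  (forall y, `|y - x| <= d -> forall k, `|'D_(delta_mx 0 k) F y| <= C) ->
  {for x, continuous F}.
Proof.
move=> d0 dF DC; apply/(@cvgrPdist_le _ _ _ _ (nbhs_filter x)) => e e0.
pose C1 := `|C| + 1.
have C1_gt0 : 0 < n.+1%:R * C1.
  by rewrite mulr_gt0 // ltr_pwDr.
have m0 : 0 < Num.min d (e / (n.+1%:R * C1)) by rewrite lt_min d0 divr_gt0.
have := nbhsx_ballx x _ m0.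
apply: (@filterS _ _ (nbhs_filter x)) => y /ball_normP.
rewrite lt_min => /andP[yd ye].
rewrite distrC; have [c cx ->] := mvt_coord dF (ltW yd).
apply: le_trans (ler_norm_sum _ _ _) _.
apply: (@le_trans _ _ (\sum_(k < n) (C1 * `|y - x|))).
  apply: ler_sum => k _; rewrite normrM; apply: ler_pM => //.
    apply: le_trans (DC _ (le_trans (cx k) (ltW yd)) k) _.
    by apply: le_trans (ler_norm _) _; rewrite lerDl.
  by have := rV_coord_le (y - x) k; rewrite !mxE.
rewrite sumr_const card_ord -mulr_natl mulrA.
apply: (@le_trans _ _ (n.+1%:R * C1 * `|y - x|)).
  by rewrite ler_wpM2r // ler_wpM2r ?ler_nat // addr_ge0.
by rewrite mulrC -ler_pdivlMr // ltW.
Qed.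

Lemma ray_integral_bounded u m F x (C : R) : 0 <= C ->
  (forall y, `|y - u| <= `|x - u| -> {for y, continuous F}) ->
  (forall y, `|y - u| <= `|x - u| -> `|F y| <= C) ->
  `|ray_integral u m F x| <= C.
Proof.
move=> C0 cF FC; have int := ray_integrable m cF.
have mI : measurable (`[0, 1]%classic : set (measurableTypeR R)).
  by exact: measurable_itv.
apply: le_trans (le_normr_Rintegral mI int) _.
have intC : mu.-integrable `[0, 1] (EFin \o (fun _ : R => C)).
  apply: continuous_compact_integrable; first exact: segment_compact.
  by apply: continuous_in_subspaceT => t _; exact: cst_continuous.
have intN := integrable_norm int.
apply: le_trans (le_Rintegral mI intN intC _) _.
  move=> t /=; rewrite in_itv /= => t01.
  rewrite normrM -[leRHS]mul1r; apply: ler_pM => //.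
    by have /andP[t0 t1] := t01; rewrite normrX ger0_norm // exprn_ile1.
  by apply: FC; exact: box_ray.
rewrite Rintegral_cst //= lebesgue_measure_itv /= lte_fin ltr01.
by rewrite oppr0 addr0 mulr1.
Qed.

Lemma ray_integral_smooth u m F (r : R) :
  smooth_on (ball u r) F -> smooth_on (ball u r) (ray_integral u m F).
Proof.
have D m' F' x k : smooth_on (ball u r) F' -> ball u r x ->
    is_derive x (delta_mx 0 k) (ray_integral u m' F')
      (ray_integral u m'.+1 ('D_(delta_mx 0 k) F') x).
  move=> sF /ball_normP xr; apply: ray_integral_derive (xr) _ _ _ => y /ball_normP yr.
  - exact: smooth_on_continuous sF yr.
  - exact: smooth_on_derivable sF yr.
  - exact: smooth_on_continuous (smooth_on_derive k sF) yr.
have oB : open (ball u r) by exact: ball_open.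
have C0 m' F' x : smooth_on (ball u r) F' -> ball u r x ->
    {for x, continuous (ray_integral u m' F')}.
  move=> sF /ball_normP xr.
  pose d : R := (r - `|x - u|) / 2.
  have d0 : 0 < d by rewrite divr_gt0 // subr_gt0.
  have sr : `|x - u| + d < r by rewrite /d; lra.
  have s0 : 0 <= `|x - u| + d by rewrite addr_ge0 // ltW.
  have Bk k : exists C, 0 <= C /\
      forall y, `|y - u| <= `|x - u| + d -> `|'D_(delta_mx 0 k) F' y| <= C.
    have [C C1 C2] := bounded_on_box s0 (fun y ys => smooth_on_continuous
      (smooth_on_derive k sF) ((ball_normP u y r).2 (le_lt_trans ys sr))).
    by exists C.
  have [C CP] := choice Bk.
  have yd y : `|y - x| <= d -> `|y - u| <= `|x - u| + d.
    move=> yx; rewrite -(subrK x y) -addrA addrC.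
    by apply: le_trans (ler_normD _ _) _; rewrite lerD2l.
  apply: (@continuous_bounded_partials _ _ d (\sum_k C k)) => // y /yd yu k.
    by case: (D m' F' y k sF ((ball_normP u y r).2 (le_lt_trans yu sr))).
  have [_ ->] := D m' F' y k sF ((ball_normP u y r).2 (le_lt_trans yu sr)).
  apply: (@le_trans _ _ (C k)); last first.
    rewrite (bigD1 k) //= lerDl sumr_ge0 // => j _; by have [] := CP j.
  have [Ck CkP] := CP k.
  apply: ray_integral_bounded => // z zy; last exact/CkP/(le_trans zy).
  apply: (smooth_on_continuous (smooth_on_derive k sF)); apply/ball_normP.
  exact: le_lt_trans (le_trans zy yu) sr.
move=> sF j; elim: j m F sF => [|j IH] m F sF.
  by split=> // x xr; exact: C0.
split; first by move=> x xr; exact: C0.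
move=> k; split; first by move=> x xr; case: (D m F x k sF xr).
apply: (Ck_on_eq oB _ (IH m.+1 _ (smooth_on_derive k sF))) => x xr.
by case: (D m F x k sF xr).
Qed.

(** Integrate the derivative of [F] along the segment from [u] to [x]. *)
Lemma hadamard u F (r : R) : 0 < r -> smooth_on (ball u r) F ->
  exists G : 'I_n -> 'rV[R]_n -> R, [/\
    forall k, smooth_on (ball u r) (G k),
    forall k, G k u = 'D_(delta_mx 0 k) F u &
    forall x, ball u r x -> F x = F u + \sum_k (x 0 k - u 0 k) * G k x].
Proof.
move=> r0 sF; exists (fun k => ray_integral u 0 ('D_(delta_mx 0 k) F)).
have mI : measurable (`[0, 1]%classic : set (measurableTypeR R)).
  by exact: measurable_itv.
split=> [k|k|x /ball_normP xr].
- exact/ray_integral_smooth/smooth_on_derive.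
- rewrite /ray_integral subrr.
  under eq_Rintegral do rewrite scaler0 addr0 expr0 mul1r.
  rewrite Rintegral_cst //= lebesgue_measure_itv /= lte_fin ltr01.
  by rewrite oppr0 addr0 mulr1.
have cF k y : `|y - u| <= `|x - u| -> {for y, continuous ('D_(delta_mx 0 k) F)}.
  move=> yx; apply: (smooth_on_continuous (smooth_on_derive k sF)).
  by apply/ball_normP; exact: le_lt_trans xr.
have int k := ray_integrable 0 (cF k).
pose g (k : 'I_n) (t : R) := (x 0 k - u 0 k) * (t ^+ 0 * 'D_(delta_mx 0 k) F (u + t *: (x - u))).
have dg (t : R) : 0 <= t <= 1 -> is_derive t (1 : R) (fun t : R => F (u + t *: (x - u)))
    (\sum_k g k t).
  move=> t01.
  have yr : ball u r (u + t *: (x - u)).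
    by apply/ball_normP; apply: le_lt_trans xr; exact: box_ray.
  have dc k : is_derive t (1 : R) (fun t : R => (u + t *: (x - u)) 0 k) (x 0 k - u 0 k).
    have := @is_deriveD _ _ _ _ _ t (1:R) _ _ (is_derive_cst (u 0 k) t (1:R))
      (@is_deriveZ _ _ _ _ (x 0 k - u 0 k) t (1:R) _ (is_derive_id t (1:R))).
    rewrite add0r /GRing.scale /= mulr1 => H.
    have -> : (fun t : R => (u + t *: (x - u)) 0 k) =
       (cst (u 0 k) + (x 0 k - u 0 k) *: id) by apply/funext => t'; rewrite !mxE mulrC.
    exact: H.
  have /(_ _ _ _)/is_derive_eq H := @chain_rule R n _ (fun t : R => u + t *: (x - u)) F
    (ball u r) t (1 : R) (ball_open _ _) yr.
  apply: H => [y yB k|k|k|].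
  - exact: smooth_on_derivable sF yB.
  - exact: smooth_on_continuous (smooth_on_derive k sF) yr.
  - by case: (dc k).
  - by apply: eq_bigr => k _; case: (dc k) => _ ->; rewrite /g expr0 mul1r mulrC.
have cg k (t : R) : 0 <= t <= 1 -> {for t, continuous (g k)}.
  move=> t01.
  have c0 : {for t, continuous (fun _ : R => x 0 k - u 0 k)} by exact: cst_continuous.
  have c1 : {for t, continuous (fun t : R => t ^+ 0)} by exact: exprn_continuous.
  have c2 : {for t, continuous (fun t : R => 'D_(delta_mx 0 k) F (u + t *: (x - u)))}.
    apply: (@continuous_comp _ _ _ (fun t : R => u + t *: (x - u))
      ('D_(delta_mx 0 k) F)); first exact: ray_continuous.
    by apply: cF; exact: box_ray.
  exact: (continuousM c0 (continuousM c1 c2)).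
have gint k : mu.-integrable `[0, 1] (EFin \o g k).
  apply: continuous_compact_integrable; first exact: segment_compact.
  by apply: continuous_in_subspaceT => t; rewrite inE /= in_itv /=; exact: cg.
have sum_int (s : seq 'I_n) : mu.-integrable `[0, 1] (EFin \o (fun t => \sum_(k <- s) g k t)) /\
   \int[mu]_(t in `[0, 1]) (\sum_(k <- s) g k t) =
   \sum_(k <- s) (x 0 k - u 0 k) * ray_integral u 0 ('D_(delta_mx 0 k) F) x.
  elim: s => [|k s [IH1 IH2]].
    split.
      rewrite (_ : _ \o _ = cst 0%E); last by apply/funext => t /=; rewrite big_nil.
      exact: integrable0.
    under eq_Rintegral do rewrite big_nil.
    by rewrite big_nil Rintegral_cst // mul0r.
  split.
    rewrite (_ : _ \o _ = (fun t => (g k t)%:E + (\sum_(k <- s) g k t)%R%:E)%E).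
      exact: (integrableD mI (gint k) IH1).
    by apply/funext => t /=; rewrite big_cons EFinD.
  under eq_Rintegral do rewrite big_cons.
  by rewrite RintegralD // IH2 big_cons RintegralZl.
have [_ <-] := sum_int (index_enum 'I_n).
have FTC := @continuous_FTC2 R (fun t => \sum_k g k t)
  (fun t : R => F (u + t *: (x - u))) 0 1 ltr01.
rewrite /Rintegral FTC.
- by rewrite -EFinB /= scale0r scale1r addr0 addrC subrK addrC subrK.
- apply: continuous_in_subspaceT => t; rewrite inE /= in_itv /= => t01.
  apply: (cvg_big (op := +%R)); first exact: add_continuous.
  by move=> k _; exact: cg.
- have ct (t : R) : 0 <= t <= 1 -> {for t, continuous (fun t : R => F (u + t *: (x - u)))}.
    by move=> /dg[/derivable1_diffP/differentiable_continuous].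
  split.
  + move=> t; rewrite in_itv /= => /andP[t0 t1].
    by case: (dg t); rewrite ?(ltW t0) ?(ltW t1).
  + by apply: cvg_at_right_filter; apply: ct; rewrite lexx ler01.
  + by apply: cvg_at_left_filter; apply: ct; rewrite lexx ler01.
- move=> t; rewrite in_itv /= => /andP[t0 t1].
  by rewrite derive1E; case: (dg t); rewrite ?(ltW t0) ?(ltW t1).
Qed.

End Hadamard.

(** * Gluing and bump functions on a manifold *)

Section LocalSmoothness.
Variables (R : realType) (n : nat) (M : smoothManifold R n).
Implicit Types (p q : M) (f h : M -> R) (i : chart_index M).

Local Notation codom i := (chart i @` chart_dom i).

Lemma chart_codom i p : chart_dom i p -> codom i (chart i p).
Proof. by move=> ip; exists p. Qed.

Lemma chart_invK i u : codom i u -> chart i (chart_inv i u) = u.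
Proof. by move=> [p ip <-]; rewrite chartK. Qed.

Lemma chart_inv_dom i u : codom i u -> chart_dom i (chart_inv i u).
Proof. by move=> [p ip <-]; rewrite chartK. Qed.

Lemma near_chart_inv i p (A : set M) : chart_dom i p -> nbhs p A ->
  exists2 r : R, 0 < r & forall u, ball (chart i p) r u ->
    codom i u /\ A (chart_inv i u).
Proof.
move=> ip pA; have up := chart_codom ip.
have N1 : nbhs (chart i p) (codom i).
  by apply: open_nbhs_nbhs; split => //; exact: open_chart_codom.
have N2 : nbhs (chart i p) (chart_inv i @^-1` A).
  have := chart_inv_continuous i _ up; rewrite /prop_for /continuous_at chartK //.
  by move/(_ A pA).
have [r /= r0 rP] := (nbhs_ballP _ _).1 (filterI N1 N2).
by exists r => // u /rP[].
Qed.

Lemma near_chart i p (V : set 'rV[R]_n) : chart_dom i p -> nbhs (chart i p) V ->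
  \forall q \near p, chart_dom i q /\ V (chart i q).
Proof.
move=> ip pV; have := chart_continuous i _ ip; rewrite /prop_for /continuous_at => /(_ V pV) N2.
have N1 : nbhs p (chart_dom i).
  by apply: open_nbhs_nbhs; split => //; exact: open_chart_dom.
exact: (filterI N1 N2).
Qed.

(** Smoothness read in some chart at [p].  By the smoothness of the transition
    maps the choice of the chart is immaterial, which is the content of
    [smooth_near_smooth]. *)
Definition smooth_near f p := exists2 i, chart_dom i p & exists2 r : R, 0 < r &
  (ball (chart i p) r `<=` codom i) /\
  smooth_on (ball (chart i p) r) (f \o chart_inv i).

Lemma smooth_near_smooth f : (forall p, smooth_near f p) -> smooth_fun f.
Proof.
move=> sf j k; apply: Ck_on_local => x Ux.
have jp := chart_inv_dom Ux; set p := chart_inv j x in jp.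
have [i ip [r r0 [rU sr]]] := sf p.
have N1 : nbhs (chart i p) (ball (chart i p) r) by exact: nbhsx_ballx.
have [s s0 sP] := near_chart_inv jp (near_chart ip N1).
rewrite chart_invK // in sP.
exists (ball x s); first exact: ballxx.
have oB : open (ball x s) by exact: ball_open.
have oV : open (ball (chart i p) r) by exact: ball_open.
apply: (@Ck_on_eq _ _ _ _ ((f \o chart_inv i) \o (chart i \o chart_inv j))) => //.
  by move=> u /sP[_ [iu _]] /=; rewrite chartK.
apply: Ck_on_comp oB oV _ (sr k) _; first by move=> u /sP[_ []].
move=> l; apply: Ck_on_sub (chart_transition M j i l k).
move=> u /sP[uj [ui _]]; exists (chart_inv j u); last exact: chart_invK.
by split => //; exact: chart_inv_dom.
Qed.

Lemma smooth_fun_near f p : smooth_fun f -> smooth_near f p.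
Proof.
move=> sf; have [i ip] := chart_cover M p; exists i => //.
have [r r0 rP] := near_chart_inv ip filterT.
exists r => //; split; first by move=> u /rP[].
by move=> k; apply: Ck_on_sub (sf i k) => u /rP[].
Qed.

Lemma smooth_near_eq f h p : {near p, f =1 h} -> smooth_near f p -> smooth_near h p.
Proof.
move=> fh [i ip [r r0 [rU sr]]]; exists i => //.
have [s s0 sP] := near_chart_inv ip fh.
have m0 : 0 < Num.min r s by rewrite lt_min r0.
have mr : ball (chart i p) (Num.min r s) `<=` ball (chart i p) r.
  by apply: le_ball; rewrite ge_min lexx.
have ms : ball (chart i p) (Num.min r s) `<=` ball (chart i p) s.
  by apply: le_ball; rewrite ge_min lexx orbT.
exists (Num.min r s) => //; split; first exact: subset_trans rU.
move=> k; apply: Ck_on_eq (Ck_on_sub mr (sr k)); first exact: ball_open.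
by move=> x /ms/sP[].
Qed.

Lemma smooth_near_chart i p (F : 'rV[R]_n -> R) (r : R) : chart_dom i p -> 0 < r ->
  smooth_on (ball (chart i p) r) F -> smooth_near (F \o chart i) p.
Proof.
move=> ip r0 sF.
have [s s0 sP] := near_chart_inv ip filterT.
have m0 : 0 < Num.min r s by rewrite lt_min r0.
have mr : ball (chart i p) (Num.min r s) `<=` ball (chart i p) r.
  by apply: le_ball; rewrite ge_min lexx.
have ms : ball (chart i p) (Num.min r s) `<=` ball (chart i p) s.
  by apply: le_ball; rewrite ge_min lexx orbT.
exists i => //; exists (Num.min r s) => //; split; first by move=> u /ms/sP[].
move=> k; apply: Ck_on_eq (Ck_on_sub mr (sF k)); first exact: ball_open.
by move=> x /ms/sP[? _] /=; rewrite chart_invK.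
Qed.

Lemma smooth_nearM f h p : smooth_fun f -> smooth_near h p ->
  smooth_near (fun q => f q * h q) p.
Proof.
move=> sf [i ip [r r0 [rU sr]]]; exists i => //; exists r => //; split => // k.
apply: (@Ck_onM _ _ k (ball (chart i p) r) (f \o chart_inv i) (h \o chart_inv i)) => //.
  exact: ball_open.
exact: Ck_on_sub (sf i k).
Qed.

Lemma smooth_cst (c : R) : smooth_fun (fun _ : M => c).
Proof. by move=> i k; apply: Ck_on_cst; exact: open_chart_codom. Qed.

Lemma Cinf_smooth (f : Cinf M) : smooth_fun f.
Proof. by apply/asboolP; exact: valP f. Qed.

(** The way functions known only on an open set become global ones: multiplied
    by a function with support in that set, whatever values they take outside
    disappear. *)
Lemma smooth_gluing (f : Cinf M) h (A : set M) :
  (forall q, A q -> smooth_near h q) ->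
  (forall q, ~ A q -> \forall q' \near q, f q' = 0) ->
  (fun q => f q * h q) \in smooth (M := M).
Proof.
move=> sh f0; apply/asboolP; apply: smooth_near_smooth => q.
have [/sh|/f0 fq] := pselect (A q); first exact/smooth_nearM/Cinf_smooth.
apply: smooth_near_eq (smooth_fun_near q (smooth_cst 0)).
by apply: filterS fq => q' /= ->; rewrite mul0r.
Qed.

(** Pull a bump of R^n back by a chart and extend it by [0].  The support is the
    image of a compact box, hence closed because the manifold is Hausdorff. *)
Lemma bump_function p (A : set M) : nbhs p A -> exists f : Cinf M,
  (\forall q \near p, f q = 1) /\
  (forall q, ~ A q -> \forall q' \near q, f q' = 0).
Proof.
move=> pA; have [i ip] := chart_cover M p.
have [r r0 rP] := near_chart_inv ip pA.
set u := chart i p in rP.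
have r4 : 0 < r / 4 by rewrite divr_gt0.
have [B [sB B1 B0]] := bump_rV u r4.
pose K := chart_inv i @` [set y | `|y - u| <= r / 2].
have box_codom y : `|y - u| <= r / 2 -> ball u r y.
  by move=> yr; apply/ball_normP; apply: le_lt_trans yr _; lra.
have Kclosed : closed K.
  apply: compact_closed; first exact: carrier_hausdorff.
  apply: continuous_compact; last exact: compact_box.
  apply: continuous_in_subspaceT => y; rewrite inE /= => yr.
  by apply: chart_inv_continuous; have [] := rP y (box_codom y yr).
pose f q := if `[< chart_dom i q >] then B (chart i q) else 0.
have f0 q : ~ K q -> \forall q' \near q, f q' = 0.
  move=> qK; have : nbhs q (~` K).
    by apply: open_nbhs_nbhs; split => //; exact: closed_openC.
  apply: filterS => q' q'K; rewrite /f; case: asboolP => // iq'.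
  apply: B0 => xr; apply: q'K; exists (chart i q'); last exact: chartK.
  by rewrite /=; lra.
have fE q : chart_dom i q -> {near q, B \o chart i =1 f}.
  move=> iq; have : nbhs q (chart_dom i).
    by apply: open_nbhs_nbhs; split => //; exact: open_chart_dom.
  by apply: filterS => q' iq'; rewrite /f; case: asboolP.
have sf : f \in smooth (M := M).
  apply/asboolP; apply: smooth_near_smooth => q.
  have [iq|niq] := pselect (chart_dom i q).
    apply: smooth_near_eq (fE q iq) _.
    apply: (smooth_near_chart iq ltr01).
    by move=> k; apply: Ck_on_sub (sB k).
  apply: smooth_near_eq (smooth_fun_near q (smooth_cst 0)).
  have : ~ K q.
    by move=> [y yr yq]; apply: niq; rewrite -yq; apply: chart_inv_dom;
      have [] := rP y (box_codom y yr).
  by move/f0; apply: filterS => q' ->.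
exists (MkCinf sf); split => /=.
  have N : nbhs (chart i p) (ball u (r / 4)) by exact: nbhsx_ballx.
  apply: filterS (near_chart ip N) => q [iq /ball_normP/ltW/B1 qB].
  by rewrite /f; case: asboolP.
move=> q qA; apply: f0 => -[y yr yq]; apply: qA; rewrite -yq.
by have [] := rP y (box_codom y yr).
Qed.

End LocalSmoothness.

(** * Vector fields in a chart *)

Section VectorFields.
Variables (R : realType) (n : nat) (M : smoothManifold R n).
Implicit Types (p q : M) (f h : Cinf M) (X Y Z : vfield M) (i : chart_index M).

Local Notation e_ k := (delta_mx 0 k : 'rV[R]_n).

Lemma CinfD f h p : (f + h) p = f p + h p. Proof. by []. Qed.
Lemma CinfM f h p : (f * h) p = f p * h p. Proof. by []. Qed.
Lemma CinfN f p : (- f) p = - f p. Proof. by []. Qed.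
Lemma CinfB f h p : (f - h) p = f p - h p. Proof. by []. Qed.
Lemma CinfZ (c : R) f p : (c *: f) p = c * f p. Proof. by []. Qed.
Lemma Cinf0 p : (0 : Cinf M) p = 0. Proof. by []. Qed.
Lemma Cinf1 p : (1 : Cinf M) p = 1. Proof. by []. Qed.

Lemma Cinf_sum (I : Type) (r : seq I) (P : pred I) (F : I -> Cinf M) p :
  (\sum_(i <- r | P i) F i) p = \sum_(i <- r | P i) F i p.
Proof. exact: (big_morph (fun f : Cinf M => f p)). Qed.

Lemma vfieldD_at X f h p : X (f + h) p = X f p + X h p.
Proof.
have [XL _] := vfield_derivation X.
by have := XL 1 f h; rewrite !scale1r => ->.
Qed.

Lemma vfield0_at X p : X 0 p = 0.
Proof.
have := vfieldD_at X 0 0 p; rewrite addr0 => /esym/eqP.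
by rewrite addrC -subr_eq0 addrK => /eqP. Qed.

Lemma vfieldZ_at X (c : R) f p : X (c *: f) p = c * X f p.
Proof.
have [XL _] := vfield_derivation X.
have := XL c f 0; rewrite addr0 => ->; have := vfield0_at X p.
by move=> E; rewrite -[RHS]addr0 -[in RHS]E.
Qed.

Lemma vfieldB_at X f h p : X (f - h) p = X f p - X h p.
Proof. by rewrite -scaleN1r vfieldD_at vfieldZ_at mulN1r. Qed.

Lemma vfieldM_at X f h p : X (f * h) p = X f p * h p + f p * X h p.
Proof. by have [_ XM] := vfield_derivation X; rewrite XM. Qed.

Lemma vfield1_at X p : X 1 p = 0.
Proof.
have := vfieldM_at X 1 1 p; rewrite mulr1 Cinf1 mulr1 mul1r => /esym/eqP.
by rewrite -subr_eq0 addrK => /eqP.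
Qed.

Lemma vfield_sum_at X (I : Type) (r : seq I) (F : I -> Cinf M) p :
  X (\sum_(i <- r) F i) p = \sum_(i <- r) X (F i) p.
Proof.
elim: r => [|j r IH]; first by rewrite !big_nil vfield0_at.
by rewrite !big_cons vfieldD_at IH.
Qed.

(** A derivation only sees germs: with [t] a bump at [p] supported where
    [f = h], apply the Leibniz rule to the vanishing product [t * (f - h)]. *)
Lemma vfield_local X f h p : {near p, f =1 h} -> X f p = X h p.
Proof.
move=> fh; have [t [t1 t0]] := bump_function fh.
have E : t * (f - h) = 0.
  apply: Cinf_eqP => q; rewrite CinfM CinfB Cinf0.
  have [->|/t0/nbhs_singleton->] := pselect (f q = h q); last by rewrite mul0r.
  by rewrite subrr mulr0.
have := vfieldM_at X t (f - h) p.
rewrite E vfield0_at CinfB (nbhs_singleton fh) subrr mulr0 add0r.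
rewrite (nbhs_singleton t1) mul1r vfieldB_at => /esym/eqP.
by rewrite subr_eq0 => /eqP.
Qed.

Definition chart_deriv i k (f : M -> R) p : R :=
  'D_(e_ k) (f \o chart_inv i) (chart i p).

(** Derivations are first order operators.  Near [p] Hadamard's lemma writes
    [f] as [f p] plus a sum of products of [x k - x k p] with smooth functions,
    and the Leibniz rule at [p] only keeps the value of those functions. *)
Lemma vfield_chart X i (x : 'I_n -> Cinf M) p f : chart_dom i p ->
  (forall k, \forall q \near p, x k q = chart i q 0 k) ->
  X f p = \sum_k X (x k) p * chart_deriv i k f p.
Proof.
move=> ip xE; set u := chart i p.
have [r r0 rP] := near_chart_inv ip filterT.
have sf : smooth_on (ball u r) (f \o chart_inv i).
  by move=> k; apply: Ck_on_sub (Cinf_smooth f i k) => y /rP[].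
have [G [sG Gu GE]] := hadamard r0 sf.
pose A q := chart_dom i q /\ ball u r (chart i q).
have pA : \forall q \near p, A q by apply: near_chart => //; exact: nbhsx_ballx.
have [t [t1 t0]] := bump_function pA.
have sg k : (fun q => t q * G k (chart i q)) \in smooth (M := M).
  apply: (smooth_gluing (A := A)) => // q [iq qr].
  have [s s0 sP] : exists2 s, 0 < s & ball (chart i q) s `<=` ball u r.
    apply/(nbhs_ballP _ _).1; apply: open_nbhs_nbhs; split => //.
    exact: ball_open.
  apply: (smooth_near_chart iq s0) => j.
  exact: Ck_on_sub (sG k j).
pose g k : Cinf M := MkCinf (sg k).
pose f1 : Cinf M := \sum_k (x k - u 0 k *: (1 : Cinf M)) * g k.
pose f0 : Cinf M := f p *: (1 : Cinf M).
(* [x k - u 0 k] replaces the coordinate: the two agree near [p] *)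
have fE : {near p, f =1 (f0 + f1 : Cinf M)}.
  have /filter_forall := xE; apply: filterS2 (filterI pA t1) => q [[iq qr] tq] xq.
  rewrite CinfD CinfZ Cinf1 mulr1 Cinf_sum.
  have := GE _ qr; rewrite /= !chartK // => ->; congr (_ + _).
  apply: eq_bigr => k _.
  rewrite -[RHS]/((x k q - u 0 k * 1) * (t q * G k (chart i q))).
  by rewrite tq mul1r mulr1 xq.
rewrite (vfield_local X fE) vfieldD_at vfieldZ_at vfield1_at mulr0 add0r.
rewrite vfield_sum_at; apply: eq_bigr => k _.
rewrite vfieldM_at vfieldB_at vfieldZ_at vfield1_at mulr0 subr0.
rewrite CinfB CinfZ Cinf1 mulr1 (nbhs_singleton (xE k)) subrr mul0r addr0.
by rewrite /g /= (nbhs_singleton t1) mul1r Gu.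
Qed.

Section CoordinateField.
Variables (i : chart_index M) (t : Cinf M).
Hypothesis t0 : forall q, ~ chart_dom i q -> \forall q' \near q, t q' = 0.

Lemma chart_deriv_smooth k f : 
  (fun q => t q * chart_deriv i k f q) \in smooth (M := M).
Proof.
apply: (smooth_gluing (A := chart_dom i)) => // q iq.
have [r r0 rP] := near_chart_inv iq filterT.
apply: (smooth_near_chart (F := 'D_(e_ k) (f \o chart_inv i)) iq r0).
apply: smooth_on_derive.
by move=> j; apply: Ck_on_sub (Cinf_smooth f i j) => y /rP[].
Qed.

Lemma chart_coord_smooth k : (fun q => t q * chart i q 0 k) \in smooth (M := M).
Proof.
apply: (smooth_gluing (A := chart_dom i)) => // q iq.
apply: (smooth_near_chart (F := fun y => y 0 k) iq ltr01) => j.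
by apply: Ck_on_coord; exact: ball_open.
Qed.

Lemma coord_field_subproof k :
  (fun f => MkCinf (chart_deriv_smooth k f)) \in derivation (M := M).
Proof.
have df f q : chart_dom i q -> derivable (f \o chart_inv i) (chart i q) (e_ k).
  by move=> iq; exact: (smooth_on_derivable (Cinf_smooth f i) (chart_codom iq)).
have t0' q : ~ chart_dom i q -> t q = 0 by move=> /t0/nbhs_singleton.
apply/asboolP; split=> [c f h|f h]; apply: Cinf_eqP => q.
  rewrite -[LHS]/(t q * chart_deriv i k (c *: f + h : Cinf M) q).
  rewrite -[RHS]/(c * (t q * chart_deriv i k f q) + t q * chart_deriv i k h q).
  have [iq|/t0'->] := pselect (chart_dom i q); last by rewrite !mul0r mulr0 addr0.
  have := deriveD (derivableZ (k := c) (df f q iq)) (df h q iq).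
  rewrite (deriveZ c (df f q iq)) /chart_deriv => E.
  rewrite (_ : (c *: f + h : Cinf M) \o chart_inv i =
    (c \*: (f \o chart_inv i)) + (h \o chart_inv i)) // E.
  by rewrite /GRing.scale /=; ring.
rewrite -[LHS]/(t q * chart_deriv i k (f * h : Cinf M) q).
rewrite -[RHS]/(t q * chart_deriv i k f q * h q + f q * (t q * chart_deriv i k h q)).
have [iq|/t0'->] := pselect (chart_dom i q); last by rewrite !mul0r mulr0 addr0.
have := deriveM (df f q iq) (df h q iq); rewrite /chart_deriv => E.
rewrite (_ : (f * h : Cinf M) \o chart_inv i =
    (f \o chart_inv i) * (h \o chart_inv i)) // E /= chartK //.
by rewrite /GRing.scale /=; ring.
Qed.

Definition coord_field k : vfield M := MkVField (coord_field_subproof k).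

End CoordinateField.

(** Cutting the coordinate functions and the coordinate fields of a chart off by
    one and the same bump function produces global objects that are dual to
    each other near [p]. *)
Lemma local_frame p : exists i (E : 'I_n -> vfield M) (x : 'I_n -> Cinf M),
  \forall q \near p, [/\ chart_dom i q,
    forall k f, E k f q = chart_deriv i k f q,
    forall k l, E k (x l) q = (l == k)%:R &
    forall X f, X f q = \sum_k X (x k) q * E k f q].
Proof.
have [i ip] := chart_cover M p; exists i.
have pi : nbhs p (chart_dom i).
  by apply: open_nbhs_nbhs; split => //; exact: open_chart_dom.
have [t [t1 t0]] := bump_function pi.
exists (fun k => coord_field t0 k), (fun k => MkCinf (chart_coord_smooth t0 k)).
have := nbhs_interior t1.
apply: filterS2 (nbhs_interior pi) => q iq tq.
have tq1 := nbhs_singleton tq; have iq1 := nbhs_singleton iq.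
have E k f : coord_field t0 k f q = chart_deriv i k f q by rewrite /= tq1 mul1r.
have xE k : \forall q' \near q, MkCinf (chart_coord_smooth t0 k) q' = chart i q' 0 k.
  by apply: filterS tq => q' /= ->; rewrite mul1r.
split => // [k l|X f]; last first.
  by rewrite (vfield_chart X f iq1 xE); apply: eq_bigr => k _; rewrite E.
rewrite E /chart_deriv.
have [r r0 rP] := near_chart_inv iq1 (filterI (xE l) iq).
have near_u : {near chart i q, (fun y : 'rV[R]_n => y 0 l) =1
     MkCinf (chart_coord_smooth t0 l) \o chart_inv i}.
  have := nbhsx_ballx (chart i q) r r0.
  apply: (@filterS _ _ (nbhs_filter (chart i q))) => y /rP[yc [/= -> _]].
  by rewrite chart_invK.
rewrite -(near_eq_derive _ near_u).
by have [_ ->] := is_derive_coord l k (chart i q).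
Qed.

End VectorFields.

(** * Symmetric forms invariant under x /\ by + bx /\ y *)

Section SymmetricProduct.
Variables (R : realFieldType) (n : nat).
Implicit Types (P Q v w x y : 'rV[R]_n) (z : 'cV[R]_n) (G B H : 'M[R]_n).

(** Symmetric product of two linear forms, as a symmetric bilinear form. *)
Definition sprod P Q : 'M[R]_n := P^T *m Q + Q^T *m P.

Local Notation pr v z := ((v *m z) 0 0).

Lemma mul_rV_cV11 (A : 'M[R]_1) v : A *m v = A 0 0 *: v.
Proof. by rewrite [A in LHS]mx11_scalar mul_scalar_mx. Qed.

Lemma sprod_col P Q z : z^T *m sprod P Q = pr P z *: Q + pr Q z *: P.
Proof.
rewrite mulmxDr !mulmxA -!trmx_mul !mul_rV_cV11; 
congr (_ + _); congr (_ *: _); by rewrite mxE.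
Qed.

Lemma prD v w z : pr (v + w) z = pr v z + pr w z.
Proof. by rewrite mulmxDl mxE. Qed.

Lemma prZ (a : R) v z : pr (a *: v) z = a * pr v z.
Proof. by rewrite -scalemxAl mxE. Qed.

Lemma prN v z : pr (- v) z = - pr v z.
Proof. by rewrite mulNmx mxE. Qed.

Lemma pr0 z : pr (0 : 'rV[R]_n) z = 0.
Proof. by rewrite mul0mx mxE. Qed.

Lemma dual_pair v w : row_free (col_mx v w) -> exists z1 z2 : 'cV[R]_n,
  [/\ pr v z1 = 1, pr w z1 = 0, pr v z2 = 0 & pr w z2 = 1].
Proof.
move=> /mulmxKp - /(_ _ 1%:M); rewrite mul1mx.
set Z := pinvmx _; rewrite mul_col_mx => E.
have colE u k : pr u (col k Z) = (u *m Z) 0 k.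
  by rewrite !mxE; apply: eq_bigr => i _; rewrite mxE.
exists (col (lshift 1 ord0) Z), (col (rshift 1 ord0) Z); split; rewrite colE.
- by rewrite -(col_mxEu (v *m Z) (w *m Z)) E mxE.
- by rewrite -(col_mxEd (v *m Z) (w *m Z)) E mxE.
- by rewrite -(col_mxEu (v *m Z) (w *m Z)) E mxE.
- by rewrite -(col_mxEd (v *m Z) (w *m Z)) E mxE.
Qed.

(** Contract with the vectors dual to [v] and [w]. *)
Lemma sprod_dep v w P Q : row_free (col_mx v w) ->
  sprod P w + sprod Q v = 0 -> exists k : R, P = k *: v /\ Q = - k *: w.
Proof.
move=> /dual_pair[z1 [z2 [v1 w1 v2 w2]]] E.
have E1 : z1^T *m (sprod P w + sprod Q v) = 0 by rewrite E mulmx0.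
have E2 : z2^T *m (sprod P w + sprod Q v) = 0 by rewrite E mulmx0.
move: E1 E2; rewrite mulmxDr (mulmxDr z2^T) !sprod_col v1 w1 v2 w2.
rewrite !scale0r !scale1r !addr0 => E1 E2.
have Pz2 : pr P z2 = 0.
  have := congr1 (fun x => pr x z2) E2.
  rewrite !prD !prZ v2 w2 pr0; lra.
have Qz1 : pr Q z1 = 0.
  have := congr1 (fun x => pr x z1) E1.
  rewrite !prD !prZ v1 w1 pr0; lra.
move: E1 E2; rewrite Pz2 Qz1 !scale0r !add0r => E1 E2.
have QE : Q = - (pr P z1 *: w) by apply/eqP; rewrite -addr_eq0 addrC E1.
have PE : P = - (pr Q z2 *: v) by apply/eqP; rewrite -addr_eq0 E2.
exists (pr P z1); split; last by rewrite scaleNr.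
have : pr P z1 = - pr Q z2 by rewrite [in LHS]PE prN prZ v1 mulr1.
by move=> ->; rewrite scaleNr.
Qed.

Lemma annihilator (k : nat) (A : 'M[R]_(k, n)) : (k < n)%N ->
  exists2 z : 'cV[R]_n, z != 0 & A *m z = 0.
Proof.
move=> kn; have : kermx A^T != 0.
  rewrite -mxrank_eq0 mxrank_ker mxrank_tr -lt0n subn_gt0.
  exact: leq_ltn_trans (rank_leq_row A) kn.
case/rowV0Pn => u /sub_kermxP uA u0; exists u^T.
  by rewrite -(inj_eq trmx_inj) trmxK trmx0.
by apply: trmx_inj; rewrite trmx_mul trmxK uA trmx0.
Qed.

Lemma dual_vector (z : 'cV[R]_n) : z != 0 -> exists v, pr v z = 1.
Proof.
move=> z0; have /cV0Pn[k zk] := z0.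
exists ((z k 0)^-1 *: delta_mx 0 k); rewrite prZ.
suff -> : pr (delta_mx 0 k : 'rV[R]_n) z = z k 0 by rewrite mulVf.
by rewrite -rowE mxE.
Qed.

(** An operator for which every vector is an eigenvector is a homothety; here
    the operator is [B] read through [G]. *)
Lemma nonscalar_pair G B : (1 < n)%N -> G \in unitmx ->
  (forall c : R, B <> c *: G) -> exists v, row_free (col_mx (v *m G) (v *m B)).
Proof.
move=> n1 uG BG; apply: contrapT => H.
have dep v : v != 0 -> exists m : R, v *m B = m *: (v *m G).
  move=> v0; have vG0 : v *m G != 0.
    by apply: contraNneq v0 => vG; rewrite -(mulmxK uG v) vG mul0mx.
  have nfree : ~~ row_free (col_mx (v *m G) (v *m B)).
    by apply/negP => f; apply: H; exists v.
  have [c c0 cE] : exists2 c : 'rV[R]_(1 + 1), c != 0 &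
      c *m col_mx (v *m G) (v *m B) = 0.
    have : kermx (col_mx (v *m G) (v *m B)) != 0 by rewrite kermx_eq0.
    by case/rowV0Pn => c /sub_kermxP cE c0; exists c.
  move: cE; rewrite -[c]hsubmxK mul_row_col.
  set a := lsubmx c; set d := rsubmx c.
  rewrite (mx11_scalar a) (mx11_scalar d) !mul_scalar_mx.
  have [d0|d0] := eqVneq (d 0 0) 0.
    rewrite d0 scale0r addr0 => /eqP; rewrite scaler_eq0 (negbTE vG0) orbF => /eqP a0.
    case/eqP: c0; rewrite -[c]hsubmxK -/a -/d (mx11_scalar a) (mx11_scalar d) a0 d0.
    by rewrite !raddf0 row_mx0.
  move=> /eqP; rewrite addrC addr_eq0 => /eqP E.
  exists (- (a 0 0 / d 0 0)); apply: (scalerI d0).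
  by rewrite E scalerA mulrN mulrC divfK // scaleNr.
have n0 : (0 < n)%N by exact: ltnW.
pose k0 := Ordinal n0.
have e0 (k : 'I_n) : delta_mx 0 k != 0 :> 'rV[R]_n.
  by apply/eqP => /matrixP/(_ 0 k); rewrite !mxE !eqxx => /eqP; rewrite oner_eq0.
have [c cE] := dep _ (e0 k0).
apply: (BG c); apply/row_matrixP => k; rewrite !rowE -scalemxAr.
have [->//|kk0] := eqVneq k k0.
have [d dE] := dep _ (e0 k).
have s0 : delta_mx 0 k + delta_mx 0 k0 != 0 :> 'rV[R]_n.
  apply/eqP => /matrixP/(_ 0 k); rewrite !mxE !eqxx (negbTE kk0) addr0.
  by move/eqP; rewrite oner_eq0.
have [m mE] := dep _ s0.
have : ((d - m) *: delta_mx 0 k + (c - m) *: delta_mx 0 k0 : 'rV[R]_n) *m G = 0.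
  rewrite mulmxDl -!scalemxAl !scalerBl -dE -cE addrACA -mulmxDl mE.
  by rewrite -opprD -scalerDr -mulmxDl subrr.
move/(congr1 (mulmx^~ (invmx G))); rewrite mulmxK // mul0mx => /matrixP E.
have := E 0 k; rewrite !mxE !eqxx (negbTE kk0) mulr0 mulr1 addr0 => /eqP.
rewrite subr_eq0 => /eqP dm.
have := E 0 k0; rewrite !mxE !eqxx eq_sym (negbTE kk0) mulr0 mulr1 add0r => /eqP.
by rewrite subr_eq0 => /eqP cm; rewrite dE dm cm.
Qed.

(** Write [b] for the operator with [B = b G].  The hypothesis on [H] says that
    the operators x /\ by + bx /\ y, where (x /\ y) z = g(y, z) x - g(x, z) y,
    are skew-adjoint for [H]; in terms of linear forms it is an identity
    between symmetric products.  Choose [v] with [v] and [b v] independent, and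
    put [y = v]: if [v H = 0], three products remain, and two of them have a
    factor among the two forms [v'] and [w'] given by [v G] and [v B].  A vector
    [z] annihilated by both exists because [n > 2], and contracting with it shows
    that the form of [b v] under [H] is a multiple of [v'] as soon as
    [H (z, x0) = 0], a single numerical condition.  Then all forms [x H] are
    multiples of [v'], and comparing with [x b H] forces them to vanish. *)
Lemma invariant_form_determined G B : (2 < n)%N -> G^T = G -> G \in unitmx ->
  (forall c : R, B <> c *: G) ->
  exists v (u u' : 'rV[R]_n), forall H, H^T = H ->
   (forall x y, sprod (y *m B) (x *m H) - sprod (x *m B) (y *m H) +
     sprod (y *m G) (x *m B *m invmx G *m H) -
     sprod (x *m G) (y *m B *m invmx G *m H) = 0) ->
   v *m H = 0 -> u *m H *m u'^T = 0 -> H = 0.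
Proof.
move=> n2 Gs uG BG.
have [v vfree] := nonscalar_pair (ltnW n2) uG BG.
set v' := v *m G in vfree; set w' := v *m B in vfree.
have [z1 [z2 [v1 w1 v2 w2]]] := dual_pair vfree.
have [z z0 zP] := annihilator (col_mx v' w') n2.
have [vz wz] : pr v' z = 0 /\ pr w' z = 0.
  move: zP; rewrite mul_col_mx -[RHS]vsubmxK => /eq_col_mx[-> ->].
  by split; rewrite !mxE.
have Gz0 : G *m z != 0.
  by apply: contraNneq z0 => Gz; rewrite -(mulKmx uG z) Gz mulmx0.
have [x0 xz] := dual_vector Gz0.
rewrite mulmxA in xz.
exists v, z^T, x0 => H Hs HP vH uH.
have {}uH : pr (x0 *m H) z = 0.
  have := congr1 trmx uH; rewrite !trmx_mul !trmxK Hs trmx0 mulmxA => ->.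
  by rewrite mxE.
pose b := B *m invmx G.
have {}HP x : sprod w' (x *m H) + sprod v' (x *m b *m H) -
    sprod (x *m G) (v *m b *m H) = 0.
  have := HP x v; rewrite vH /sprod trmx0 !mul0mx !mulmx0 addr0 subr0.
  by rewrite -/v' -/w' /b !mulmxA.
set wH := v *m b *m H in HP.
have row0 : pr (x0 *m b *m H) z *: v' - (wH + pr wH z *: (x0 *m G)) = 0.
  have := congr1 (fun A : 'M[R]_n => z^T *m A) (HP x0).
  rewrite mulmx0 mulmxDr mulmxN mulmxDr !sprod_col vz wz xz uH.
  by rewrite !scale0r !add0r scale1r.
(* contracting [row0] once more with [z] gives [- 2 * (wH z) = 0] *)
have wHz : pr wH z = 0.
  have := congr1 (fun x => pr x z) row0.
  by rewrite prD prN prD !prZ vz xz pr0; lra.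
move: row0; rewrite wHz scale0r addr0 => /eqP; rewrite subr_eq0 => /eqP wHE.
set a := pr _ _ in wHE.
have HE x : exists k : R, x *m H = k *: v' /\ x *m b *m H - a *: (x *m G) = - k *: w'.
  apply: (sprod_dep vfree); rewrite -[RHS](HP x) -wHE /sprod.
  rewrite [in LHS]linearB [in LHS]linearZ /= mulmxBl mulmxBr -!scalemxAl -!scalemxAr.
  rewrite [in RHS]linearZ /= -!scalemxAl.
  by apply/matrixP => i j; rewrite !mxE; ring.
have {}HE x : exists k k' : R, [/\ x *m H = k *: v', x *m b *m H = k' *: v' &
    k' *: v' - a *: (x *m G) = - k *: w'].
  by have [k [k1 k2]] := HE x; have [k' [k'1 _]] := HE (x *m b);
    exists k, k'; rewrite -k'1.
have a0 : a = 0.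
  by have [k [k' [_ E _]]] := HE x0; rewrite /a E prZ vz mulr0.
apply/row_matrixP => i; rewrite row0 rowE.
have [k [k' [-> _]]] := HE (delta_mx 0 i).
rewrite a0 scale0r subr0 => /(congr1 (fun x => pr x z2)).
rewrite !prZ v2 w2 mulr0 mulr1 => /esym/eqP; rewrite oppr_eq0 => /eqP ->.
by rewrite scale0r.
Qed.

End SymmetricProduct.

(** * Orthonormal bases of a nondegenerate symmetric form *)

Section OrthonormalBasis.
Variables (R : rcfType) (n : nat) (G : 'M[R]_n).
Hypotheses (Gs : G^T = G) (uG : G \in unitmx).
Implicit Types (x y v : 'rV[R]_n).

Definition bform (A : 'M[R]_n) x y := (x *m A *m y^T) 0 0.

Lemma bformDl A x y z : bform A (x + y) z = bform A x z + bform A y z.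
Proof. by rewrite /bform !mulmxDl mxE. Qed.
Lemma bformDr A x y z : bform A z (x + y) = bform A z x + bform A z y.
Proof. by rewrite /bform linearD /= mulmxDr mxE. Qed.
Lemma bformZl A (a : R) x z : bform A (a *: x) z = a * bform A x z.
Proof. by rewrite /bform -!scalemxAl mxE. Qed.
Lemma bformZr A (a : R) x z : bform A z (a *: x) = a * bform A z x.
Proof. by rewrite /bform linearZ /= -scalemxAr mxE. Qed.
Lemma bformNl A x z : bform A (- x) z = - bform A x z.
Proof. by rewrite -scaleN1r bformZl mulN1r. Qed.
Lemma bform0l A z : bform A 0 z = 0.
Proof. by rewrite /bform !mul0mx mxE. Qed.
Lemma bform_suml A (I : Type) (r : seq I) (F : I -> 'rV[R]_n) z :
  bform A (\sum_(i <- r) F i) z = \sum_(i <- r) bform A (F i) z.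
Proof.
elim: r => [|i r IH]; first by rewrite !big_nil bform0l.
by rewrite !big_cons bformDl IH.
Qed.

Lemma bformC x y : bform G x y = bform G y x.
Proof.
rewrite /bform; transitivity ((x *m G *m y^T)^T 0 0); first by rewrite [RHS]mxE.
by rewrite !trmx_mul trmxK Gs mulmxA.
Qed.

Lemma bform_nondegenerate x : (forall y, bform G x y = 0) -> x = 0.
Proof.
move=> H; suff : x *m G = 0 by move/(congr1 (mulmx^~ (invmx G))); rewrite mulmxK // mul0mx.
apply/rowP => k; have := H (delta_mx 0 k); rewrite /bform trmx_delta -colE => E.
by rewrite [RHS]mxE -E [RHS]mxE.
Qed.

Definition orthonormal (k : nat) (e : nat -> 'rV[R]_n) :=
  forall i j, (i < k)%N -> (j < k)%N ->
    if i == j then `|bform G (e i) (e i)| = 1 else bform G (e i) (e j) = 0.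

Lemma norm1_sqr (a : R) : `|a| = 1 -> a * a = 1.
Proof. by move=> a1; rewrite -expr2 -real_normK ?num_real // a1 expr1n. Qed.

Lemma mul_rows_col k (F : 'I_k -> 'rV[R]_n) (z : 'cV[R]_n) i :
  ((\matrix_i F i) *m z) i 0 = (F i *m z) 0 0.
Proof. by rewrite !mxE; apply: eq_bigr => j _; rewrite mxE. Qed.

(** A nonzero [x] orthogonal to the given vectors exists by counting dimensions,
    and pairs nontrivially with some [y'] orthogonal to them as well; one of
    [x], [y'] and [x + y'] is then not isotropic. *)
Lemma orthonormal_extend k e : (k < n)%N -> orthonormal k e ->
  exists v, `|bform G v v| = 1 /\ forall i, (i < k)%N -> bform G v (e i) = 0.
Proof.
move=> kn oe.
have [z z0 zP] := annihilator (\matrix_(i < k) (e i *m G)) kn.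
have perp0 x : (forall i, (i < k)%N -> bform G x (e i) = 0) <->
    (\matrix_(i < k) (e i *m G)) *m x^T = 0.
  split=> [H|H i ik].
    by apply/colP => i; rewrite mul_rows_col [RHS]mxE -[LHS]/(bform G (e i) x) bformC H.
  have /colP/(_ (Ordinal ik)) := H; rewrite mul_rows_col bformC /bform => ->.
  by rewrite mxE.
pose x := z^T.
have x0 : x != 0 by rewrite -(inj_eq trmx_inj) trmxK trmx0.
have xe : forall i, (i < k)%N -> bform G x (e i) = 0 by apply/perp0; rewrite trmxK.
have [y xy] : exists y, bform G x y != 0.
  apply: contrapT => H; case/eqP: x0; apply: bform_nondegenerate => y.
  by apply: contrapT => /eqP xy; apply: H; exists y.
(* remove from [y] its components along the [e i]; the pairing with [x] stays *)
pose y' := y + \sum_(i < k) (- (bform G (e i) (e i) * bform G y (e i))) *: e i.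
have y'e j : (j < k)%N -> bform G y' (e j) = 0.
  move=> jk; rewrite bformDl bform_suml (bigD1 (Ordinal jk)) //= big1 => [|i ij].
    rewrite bformZl addr0; have := oe _ _ jk jk; rewrite eqxx => /norm1_sqr H.
    by rewrite mulNr mulrAC H mul1r subrr.
  rewrite bformZl; have := oe _ _ (ltn_ord i) jk; rewrite -val_eqE /= in ij.
  by rewrite (negbTE ij) => ->; rewrite mulr0.
have xy' : bform G x y' = bform G x y.
  rewrite bformC bformDl bform_suml big1 ?addr0; first by rewrite bformC.
  by move=> i _; rewrite bformZl (bformC (e i)) xe // mulr0.
have norm v : bform G v v != 0 -> (forall i, (i < k)%N -> bform G v (e i) = 0) ->
    exists v, `|bform G v v| = 1 /\ forall i, (i < k)%N -> bform G v (e i) = 0.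
  move=> vv ve; exists ((Num.sqrt `|bform G v v|)^-1 *: v); split.
    rewrite bformZl bformZr mulrA -invfM -expr2 sqr_sqrtr // normrM normfV normr_id.
    by rewrite mulVf // normr_eq0.
  by move=> i ik; rewrite bformZl ve // mulr0.
(* if [x] and [y'] are isotropic, then [x + y'] has norm [2 * G(x, y')] *)
clearbody y'.
have [xx|xx] := eqVneq (bform G x x) 0; last exact: norm xx xe.
have [yy|yy] := eqVneq (bform G y' y') 0; last exact: norm yy y'e.
apply: (norm (x + y')).
  rewrite bformDl !bformDr xx yy (bformC y') xy' add0r addr0 -mulr2n.
  by rewrite mulrn_eq0.
by move=> i ik; rewrite bformDl xe // y'e // addr0.
Qed.

Lemma orthonormal_exists : exists e : 'I_n -> 'rV[R]_n, forall i j,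
  if i == j then `|bform G (e i) (e i)| = 1 else bform G (e i) (e j) = 0.
Proof.
have H k : (k <= n)%N -> exists e, orthonormal k e.
  elim: k => [|k IH] kn; first by exists (fun=> 0) => i j.
  have [e oe] := IH (ltnW kn).
  have [v [v1 ve]] := orthonormal_extend kn oe.
  exists (fun i => if i == k then v else e i) => i j.
  rewrite (ltnS i) (ltnS j) (leq_eqVlt i) (leq_eqVlt j).
  have [->|ik] := eqVneq i k; have [->|jk] := eqVneq j k; rewrite ?eqxx //=.
  - by move=> _ jk'; rewrite ?(negbTE jk) ?[k == j]eq_sym ?(negbTE jk) ve.
  - by move=> ik' _; rewrite ?(negbTE ik) bformC ve.
  - exact: oe.
have [e oe] := H n (leqnn n).
by exists (fun i => e i) => i j; rewrite -val_eqE; exact: oe (ltn_ord i) (ltn_ord j).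
Qed.

Section Trace.
Variable e : 'I_n -> 'rV[R]_n.
Hypothesis oe : forall i j,
  if i == j then `|bform G (e i) (e i)| = 1 else bform G (e i) (e j) = 0.

(** If the rows of [P] are the basis and [D = P G P^T], then [D] is its own
    inverse, so that the inverse of [G] is [P^T D P]. *)
Lemma orthonormal_trace (T : 'M[R]_n) :
  \sum_i bform G (e i) (e i) * bform T (e i) (e i) = \tr (invmx G *m T).
Proof.
pose P := \matrix_i e i.
pose D := P *m G *m P^T.
have PE (A : 'M[R]_n) i j : (P *m A *m P^T) i j = bform A (e i) (e j).
  rewrite /bform !mxE; apply: eq_bigr => k _; rewrite !mxE; congr (_ * _).
  by apply: eq_bigr => l _; rewrite mxE.
have DD : D *m D = 1%:M.
  apply/matrixP => i j; rewrite !mxE (bigD1 i) //= big1 => [|k ki].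
    rewrite !PE addr0; have := oe i i; rewrite eqxx => /norm1_sqr H.
    have := oe i j; case: eqVneq => [<-|ij ->]; last by rewrite mulr0.
    by rewrite H.
  by rewrite !PE; have := oe i k; rewrite eq_sym (negbTE ki) => ->; rewrite mul0r.
have H : P *m (G *m P^T *m D) = 1%:M by rewrite -DD /D !mulmxA.
have GE : invmx G = P^T *m D *m P.
  have H' : G *m (P^T *m D *m P) = 1%:M by have := mulmx1C H; rewrite !mulmxA.
  by rewrite -[RHS](mulKmx uG) H' mulmx1.
have -> : \tr (invmx G *m T) = \tr (D *m (P *m T *m P^T)).
  by rewrite GE -!mulmxA mxtrace_mulC -!mulmxA.
apply: eq_bigr => i _; rewrite [RHS]mxE (bigD1 i) //= big1 => [|k ki].
  by rewrite addr0 !PE.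
by rewrite PE; have := oe i k; rewrite eq_sym (negbTE ki) => ->; rewrite mul0r.
Qed.

End Trace.
End OrthonormalBasis.

(** * Local frames and the values of tensors at a point *)

Section Frames.
Variables (R : realType) (n : nat) (M : smoothManifold R n).
Implicit Types (p q : M) (f h : Cinf M) (X Y Z U V : vfield M).

Definition is_frame p (E : 'I_n -> vfield M) (x : 'I_n -> Cinf M) :=
  \forall q \near p, (forall k l, E k (x l) q = (l == k)%:R) /\
    (forall X f, X f q = \sum_k X (x k) q * E k f q).

Lemma frame_exists p : exists E x, is_frame p E x.
Proof.
have [i [E [x H]]] := local_frame p; exists E, x.
by apply: filterS H => q [].
Qed.

Lemma frame_near p E x : is_frame p E x -> \forall q \near p, is_frame q E x.
Proof. exact: nbhs_interior. Qed.

Lemma vfield_eqP X Y : (forall f p, X f p = Y f p) -> X = Y.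
Proof.
by move=> XY; apply: val_inj; apply/funext => f; apply: Cinf_eqP => p; exact: XY.
Qed.

Lemma vfieldD_val X Y f p : (X + Y) f p = X f p + Y f p. Proof. by []. Qed.
Lemma vfieldN_val X f p : (- X) f p = - X f p. Proof. by []. Qed.
Lemma vfieldZ_val h X f p : (h *: X) f p = h p * X f p. Proof. by []. Qed.
Lemma vfield_sum_val (I : Type) (r : seq I) (F : I -> vfield M) f p :
  (\sum_(i <- r) F i) f p = \sum_(i <- r) F i f p.
Proof. exact: (big_morph (fun X : vfield M => X f p)). Qed.

Definition tensorial1 (T : vfield M -> Cinf M) :=
  forall f X Y, T (f *: X + Y) = f * T X + T Y.

Section Tensorial.
Variable T : vfield M -> Cinf M.
Hypothesis tT : tensorial1 T.

Lemma tensorialD X Y : T (X + Y) = T X + T Y.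
Proof. by have := tT 1 X Y; rewrite scale1r mul1r. Qed.

Lemma tensorial0 : T 0 = 0.
Proof.
have := tensorialD 0 0; rewrite addr0 => /eqP.
by rewrite -subr_eq0 opprD addNKr oppr_eq0 => /eqP. Qed.

Lemma tensorialZ f X : T (f *: X) = f * T X.
Proof. by have := tT f X 0; rewrite tensorial0 !addr0. Qed.

Lemma tensorialN X : T (- X) = - T X.
Proof. by rewrite -scaleN1r tensorialZ mulN1r. Qed.

Lemma tensorial_sum (I : Type) (r : seq I) (F : I -> vfield M) :
  T (\sum_(i <- r) F i) = \sum_(i <- r) T (F i).
Proof. exact: (big_morph T tensorialD tensorial0). Qed.

(** The local expansion of a vector field becomes global once both sides are
    multiplied by a bump function, and then linearity over the ring of smooth
    functions applies. *)
Lemma frame_expand p E x X : is_frame p E x ->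
  T X p = \sum_k X (x k) p * T (E k) p.
Proof.
move=> fr; have [t [t1 t0]] := bump_function fr.
have tX : t *: X = \sum_k X (x k) *: (t *: E k).
  apply: vfield_eqP => f q; rewrite vfieldZ_val vfield_sum_val.
  have [[_ H]|/t0/nbhs_singleton tq] := pselect ((forall k l, E k (x l) q = (l == k)%:R) /\
    (forall X f, X f q = \sum_k X (x k) q * E k f q)).
    rewrite H mulr_sumr; apply: eq_bigr => k _.
    by rewrite !vfieldZ_val mulrCA.
  rewrite tq mul0r big1 // => k _.
  by rewrite !vfieldZ_val tq mul0r mulr0.
have := congr1 (fun X => T X p) tX.
rewrite tensorialZ CinfM (nbhs_singleton t1) mul1r => ->.
rewrite tensorial_sum Cinf_sum; apply: eq_bigr => k _.
by rewrite !tensorialZ !CinfM (nbhs_singleton t1) mul1r.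
Qed.

End Tensorial.

Definition tensorial2 (T : vfield M -> vfield M -> Cinf M) :=
  (forall Y, tensorial1 (T^~ Y)) /\ (forall X, tensorial1 (T X)).

Definition coords (x : 'I_n -> Cinf M) p X : 'rV[R]_n := \row_k X (x k) p.

Definition frame_vec (E : 'I_n -> vfield M) (v : 'rV[R]_n) : vfield M :=
  \sum_k (v 0 k *: (1 : Cinf M) : Cinf M) *: E k.

Definition frame_mx (E : 'I_n -> vfield M) p 
  (T : vfield M -> vfield M -> Cinf M) : 'M[R]_n :=
  \matrix_(k, l) T (E k) (E l) p.

Lemma frame_expand2 T p E x X Y : tensorial2 T -> is_frame p E x ->
  T X Y p = bform (frame_mx E p T) (coords x p X) (coords x p Y).
Proof.
move=> [T1 T2] fr; rewrite (frame_expand (T1 Y) X fr) /bform mxE.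
under eq_bigr do rewrite (frame_expand (T2 _) Y fr) mulr_sumr.
rewrite exchange_big; apply: eq_bigr => l _; rewrite !mxE mulr_suml.
by apply: eq_bigr => k _; rewrite !mxE; ring.
Qed.

Lemma coords_vec p E x v : is_frame p E x -> coords x p (frame_vec E v) = v.
Proof.
move=> /nbhs_singleton[H _]; apply/rowP => l; rewrite mxE vfield_sum_val.
rewrite (bigD1 l) // big1 => [|k kl]; rewrite vfieldZ_val H CinfZ Cinf1 mulr1.
  by rewrite eqxx mulr1; exact: addr0.
by rewrite eq_sym (negbTE kl) mulr0.
Qed.

Lemma tensor02_tensorial (H : tensor02 M) : tensorial2 H.
Proof. by split=> [Y f X Z|X f Y Z]; rewrite (tensor02_linearl, tensor02_linearr). Qed.

Variable g : semiRiemannianMetric M.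

Lemma gram_sym p E : (frame_mx E p g)^T = frame_mx E p g.
Proof. by apply/matrixP => k l; rewrite !mxE Defs.metric_sym. Qed.

Lemma gram_unit p E x : is_frame p E x -> frame_mx E p g \in unitmx.
Proof.
move=> fr; rewrite -row_free_unit -kermx_eq0; apply/rowV0P => v /sub_kermxP vG.
have H : forall Y, g (frame_vec E v) Y p = 0.
  move=> Y; rewrite (frame_expand2 _ _ (tensor02_tensorial g) fr) (coords_vec v fr).
  by rewrite /bform vG mul0mx mxE.
have := metric_nondegenerate H => H'.
by rewrite -(coords_vec v fr); apply/rowP => k; rewrite !mxE H'.
Qed.

Lemma orthonormal_basisP p : orthonormal_at g p (orthonormal_basis g p).
Proof.
have [E [x fr]] := frame_exists p.
have [e oe] := orthonormal_exists (gram_sym p E) (gram_unit fr).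
rewrite /orthonormal_basis; case: xgetP => [y -> //|/(_ (fun i => frame_vec E (e i)))[]].
move=> i j; have := oe i j.
by rewrite !(frame_expand2 _ _ (tensor02_tensorial g) fr) !(coords_vec _ fr).
Qed.

(** In this form the contraction does not refer to the orthonormal basis chosen
    at each point, and its smooth dependence on the point becomes visible. *)
Lemma gram_trace p E x T : tensorial2 T -> is_frame p E x ->
  let e := orthonormal_basis g p in
  \sum_(i < n) g (e i) (e i) p * T (e i) (e i) p = \tr (invmx (frame_mx E p g) *m frame_mx E p T).
Proof.
move=> tT fr e; have := orthonormal_basisP p; rewrite -/e => oe.
pose v i := coords x p (e i).
rewrite -(orthonormal_trace (gram_unit fr) (e := v)) => [|i j].
  apply: eq_bigr => i _.
  by rewrite (frame_expand2 _ _ (tensor02_tensorial g) fr) (frame_expand2 _ _ tT fr).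
by have := oe i j; rewrite !(frame_expand2 _ _ (tensor02_tensorial g) fr).
Qed.

End Frames.

(** * Smoothness and covariant derivative of traces *)

Section TraceDerivative.
Variables (R : realType) (n : nat) (M : smoothManifold R n).
Implicit Types (p q : M) (f h : Cinf M) (X Y Z U V : vfield M).

Section Evaluation.
Variable p : M.
(** Naming the evaluation at a point makes it a ring morphism, to which the
    determinant and the adjugate matrix are transparent. *)
Definition evalC f : R := f p.
Fact evalC_zmod : zmod_morphism evalC. Proof. by []. Qed.
Fact evalC_monoid : monoid_morphism evalC. Proof. by []. Qed.
HB.instance Definition _ := GRing.isZmodMorphism.Build (Cinf M) R evalC evalC_zmod.
HB.instance Definition _ := GRing.isMonoidMorphism.Build (Cinf M) R evalC evalC_monoid.
End Evaluation.

Lemma det_Cinf (A : 'M[Cinf M]_n) p : (\det A) p = \det (map_mx (evalC p) A).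
Proof. exact: (esym (det_map_mx (evalC p) A)). Qed.

Lemma adj_Cinf (A : 'M[Cinf M]_n) p k l : (\adj A k l) p = \adj (map_mx (evalC p) A) k l.
Proof. by rewrite -map_mx_adj [RHS]mxE. Qed.

Lemma smooth_nearV f p : f p != 0 -> smooth_near (fun q => (f q)^-1) p.
Proof.
move=> fp; have [i ip] := chart_cover M p; exists i => //.
have ci : {for chart i p, continuous (f \o chart_inv i)}.
  exact: (smooth_on_continuous (Cinf_smooth f i) (chart_codom ip)).
have N1 : nbhs (chart i p) [set u | (f \o chart_inv i) u != 0].
  apply: (ci [set y | y != 0]); rewrite /= chartK //.
  by apply: open_nbhs_nbhs; split => //; exact: open_neq.
have N2 : nbhs (chart i p) (chart i @` chart_dom i).
  by apply: open_nbhs_nbhs; split; [exact: open_chart_codom|exact: chart_codom].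
have [r /= r0 rP] := (nbhs_ballP _ _).1 (filterI N1 N2).
exists r => //; split; first by move=> u /rP[].
move=> k; apply: (@Ck_onV _ _ k _ (f \o chart_inv i)).
- exact: ball_open.
- by move=> u /rP[].
- by apply: Ck_on_sub (Cinf_smooth f i k) => u /rP[].
Qed.

Lemma inverse_near f p : f p != 0 -> exists h : Cinf M, \forall q \near p, h q * f q = 1.
Proof.
move=> fp.
have N : \forall q \near p, f q != 0.
  have [i ip] := chart_cover M p.
  have ci : {for chart i p, continuous (f \o chart_inv i)}.
    exact: (smooth_on_continuous (Cinf_smooth f i) (chart_codom ip)).
  have N1 : nbhs (chart i p) [set u | (f \o chart_inv i) u != 0].
    apply: (ci [set y | y != 0]); rewrite /= chartK //.
    by apply: open_nbhs_nbhs; split => //; exact: open_neq.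
  by apply: filterS (near_chart ip N1) => q [iq] /=; rewrite chartK.
have [t [t1 t0]] := bump_function N.
have sh : (fun q => t q * (f q)^-1) \in smooth (M := M).
  by apply: (smooth_gluing (A := fun q => f q != 0)) => // q; exact: smooth_nearV.
exists (MkCinf sh); apply: filterS2 N t1 => q fq tq /=.
by rewrite tq mul1r mulVf.
Qed.

Variables (g : semiRiemannianMetric M).

(** Cramer's rule: the inverse of the Gram matrix of a frame has smooth
    entries. *)
Lemma inverse_gram p E x : is_frame p E x -> exists c : 'I_n -> 'I_n -> Cinf M,
  \forall q \near p, invmx (frame_mx E q g) = \matrix_(k, l) c k l q.
Proof.
move=> fr; pose A : 'M[Cinf M]_n := \matrix_(k, l) g (E k) (E l).
have AE q : map_mx (evalC q) A = frame_mx E q g by apply/matrixP => k l; rewrite !mxE.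
have d0 : (\det A) p != 0.
  by rewrite det_Cinf AE; have := gram_unit g fr; rewrite unitmxE unitfE.
have [h hP] := inverse_near d0.
exists (fun k l => h * \adj A k l).
apply: filterS2 (frame_near fr) hP => q frq hq.
rewrite /invmx (gram_unit g frq); apply/matrixP => k l.
rewrite [LHS]mxE [RHS]mxE CinfM adj_Cinf AE; congr (_ * _).
have dq : \det (frame_mx E q g) != 0 by have := gram_unit g frq; rewrite unitmxE unitfE.
by apply: (mulIf dq); rewrite mulVf // -hq det_Cinf AE.
Qed.

Lemma trace_near p E x T (c : 'I_n -> 'I_n -> Cinf M) : tensorial2 T -> is_frame p E x ->
  (\forall q \near p, invmx (frame_mx E q g) = \matrix_(k, l) c k l q) ->
  \forall q \near p, (let e := orthonormal_basis g q in
    \sum_(i < n) g (e i) (e i) q * T (e i) (e i) q) =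
    (\sum_k \sum_l c k l * T (E l) (E k)) q.
Proof.
move=> tT fr; apply: filterS2 (frame_near fr) => q frq cq.
rewrite (gram_trace g tT frq) cq /mxtrace Cinf_sum; apply: eq_bigr => k _.
by rewrite mxE Cinf_sum; apply: eq_bigr => l _; rewrite !mxE.
Qed.

(** The pointwise contraction is smooth, by its expression in local frames, and
    therefore it is what [trace_g] computes. *)
Lemma trace_gE T p : tensorial2 T -> let e := orthonormal_basis g p in
  trace_g g T p = \sum_(i < n) g (e i) (e i) p * T (e i) (e i) p.
Proof.
move=> tT e; rewrite /trace_g.
pose F (q : M) := let e := orthonormal_basis g q in
    \sum_(i < n) g (e i) (e i) q * T (e i) (e i) q.
have sF : F \in smooth (M := M).
  apply/asboolP; apply: smooth_near_smooth => q.
  have [E [x fr]] := frame_exists q.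
  have [c cP] := inverse_gram fr.
  apply: smooth_near_eq (smooth_fun_near q (Cinf_smooth (\sum_k \sum_l c k l * T (E l) (E k)))).
  by apply: filterS (trace_near tT fr cP) => q' /esym.
by rewrite -/F insubdK.
Qed.

Variable D : linearConnection M.
Hypothesis gD : metric_connection g D.

Lemma cov_deriv2_tensorial T U : tensorial2 T -> tensorial2 (cov_deriv2 D T U).
Proof.
move=> [T1 T2].
have T1D X Y Z : T (X + Y) Z = T X Z + T Y Z := tensorialD (T1 Z) X Y.
have T1Z f X Z : T (f *: X) Z = f * T X Z := tensorialZ (T1 Z) f X.
have T2D X Y Z : T X (Y + Z) = T X Y + T X Z := tensorialD (T2 X) Y Z.
have T2Z f X Y : T X (f *: Y) = f * T X Y := tensorialZ (T2 X) f Y.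
split=> [Y f X Z|X f Y Z]; apply: Cinf_eqP => p; rewrite /cov_deriv2.
  rewrite connection_additiver connection_leibniz !(T1D, T1Z).
  rewrite !(CinfD, CinfB, CinfN, CinfM) vfieldD_at vfieldM_at; ring.
rewrite connection_additiver connection_leibniz !(T2D, T2Z).
rewrite !(CinfD, CinfB, CinfN, CinfM) vfieldD_at vfieldM_at; ring.
Qed.

(** Contraction commutes with covariant differentiation, because the metric is
    parallel.  In a frame, with [C] the inverse of the Gram matrix [G] and [N]
    the matrix of the connection in the direction [U], parallelism of the
    metric reads [U G = N G + G N^T], hence [U C = - (C N + N^T C)], and the
    terms with [N] cancel in the derivative of the trace of [C T]. *)
Lemma trace_cov_deriv2 T U : tensorial2 T ->
  trace_g g (cov_deriv2 D T U) = U (trace_g g T).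
Proof.
move=> tT; have [T1 T2] := tT; apply: Cinf_eqP => p.
have [E [x fr]] := frame_exists p.
have [c cP] := inverse_gram fr.
pose C := \matrix_(k, l) c k l p.
pose UC := \matrix_(k, l) U (c k l) p.
pose G := frame_mx E p g.
pose N := \matrix_(k, l) D U (E k) (x l) p.
have CG : C = invmx G by rewrite (nbhs_singleton cP).
have uG := gram_unit g fr.
have mat_deriv S k l : tensorial2 S -> U (S (E k) (E l)) p =
    (frame_mx E p (cov_deriv2 D S U) + N *m frame_mx E p S + frame_mx E p S *m N^T) k l.
  move=> [S1 S2].
  have -> : U (S (E k) (E l)) p = cov_deriv2 D S U (E k) (E l) p +
      S (D U (E k)) (E l) p + S (E k) (D U (E l)) p.
    rewrite /cov_deriv2 !CinfB; ring.
  rewrite (frame_expand (S1 _) _ fr) (frame_expand (S2 _) _ fr) !mxE.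
  congr (_ + _ + _); apply: eq_bigr => m _; rewrite !mxE //; exact: mulrC.
have UG k l : U (g (E k) (E l)) p = (N *m G + G *m N^T) k l.
  rewrite (mat_deriv g k l (tensor02_tensorial g)) !mxE.
  by rewrite gD Cinf0 add0r.
have UCG : UC *m G + C *m (N *m G + G *m N^T) = 0.
  apply/matrixP => k l; rewrite [RHS]mxE.
  have near1 : {near p, (\sum_m c k m * g (E m) (E l)) =1 ((k == l)%:R *: (1 : Cinf M) : Cinf M)}.
    apply: filterS2 (frame_near fr) cP => q frq cq.
    have := mulVmx (gram_unit g frq); rewrite cq => /matrixP/(_ k l).
    rewrite [RHS]mxE => E1; rewrite CinfZ Cinf1 mulr1 -E1 Cinf_sum mxE.
    by apply: eq_bigr => m _; rewrite !mxE.
  have := vfield_local U near1; rewrite vfieldZ_at vfield1_at mulr0.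
  rewrite vfield_sum_at => E1; rewrite -[RHS]E1 mxE.
  rewrite [X in X + _]mxE [X in _ + X]mxE -big_split; apply: eq_bigr => m _.
  by rewrite vfieldM_at UG !mxE.
have UCE : UC = - (C *m N + N^T *m C).
  have GC : G *m C = 1%:M by rewrite CG mulmxV.
  have CG1 : C *m G = 1%:M by rewrite CG mulVmx.
  rewrite -[LHS]mulmx1 -GC mulmxA.
  have -> : UC *m G = - (C *m (N *m G + G *m N^T)) by apply/eqP; rewrite -addr_eq0 UCG.
  rewrite mulNmx mulmxDr mulmxDl -!mulmxA GC mulmx1 (mulmxA C G) CG1 mul1mx.
  by [].
have near2 : {near p, trace_g g T =1 (\sum_k \sum_l c k l * T (E l) (E k))}.
  by apply: filterS (trace_near tT fr cP) => q <-; exact: trace_gE.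
have tdT := cov_deriv2_tensorial U tT.
rewrite (vfield_local U near2) (trace_gE _ tdT) (gram_trace g tdT fr) -/G -CG.
set T' := frame_mx E p _; set Tm := frame_mx E p T.
transitivity (\tr (UC *m Tm) + \tr (C *m (T' + N *m Tm + Tm *m N^T))).
  have E1 : \tr (C *m (Tm *m N^T)) = \tr (N^T *m C *m Tm).
    by rewrite mulmxA mxtrace_mulC mulmxA.
  have E2 : C *m (N *m Tm) = C *m N *m Tm by rewrite mulmxA.
  rewrite UCE mulNmx mulmxDl !mulmxDr E2.
  have trD (A B : 'M[R]_n) : \tr (A + B) = \tr A + \tr B by exact: raddfD.
  have trN (A : 'M[R]_n) : \tr (- A) = - \tr A by exact: raddfN.
  rewrite trN !trD E1; ring.
rewrite vfield_sum_at -raddfD /= /mxtrace; apply: eq_bigr => k _.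
rewrite vfield_sum_at !mxE -big_split; apply: eq_bigr => l _ /=.
by rewrite vfieldM_at mat_deriv // !mxE.
Qed.

End TraceDerivative.

(** * The curvature tensor of a connection *)

Section CurvatureTensor.
Variables (R : realType) (n : nat) (M : smoothManifold R n).
Implicit Types (p q : M) (f h : Cinf M) (X Y Z U V W : vfield M).
Variables (D : linearConnection M).

Lemma bracket_linearl f X Y Z :
  bracket (f *: X + Y) Z = f *: bracket X Z - Z f *: X + bracket Y Z.
Proof.
apply: vfield_eqP => h p; rewrite -[LHS]/((f *: X + Y) (Z h) p - Z ((f *: X + Y) h) p).
rewrite vfieldD_val vfieldZ_val -[(f *: X + Y) h]/(f * X h + Y h).
rewrite vfieldD_at vfieldM_at.
rewrite -[RHS]/(f p * (X (Z h) p - Z (X h) p) - Z f p * X h p + (Y (Z h) p - Z (Y h) p)).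
ring.
Qed.

Lemma bracketC X Y : bracket Y X = - bracket X Y.
Proof.
apply: vfield_eqP => h p.
by rewrite -[LHS]/(Y (X h) p - X (Y h) p) -[RHS]/(- (X (Y h) p - Y (X h) p)) opprB.
Qed.

Lemma connectionDl X Y Z : D (X + Y) Z = D X Z + D Y Z.
Proof. by have := connection_linearl D 1 X Y Z; rewrite !scale1r. Qed.

Lemma connection0l Z : D 0 Z = 0.
Proof.
have := connectionDl 0 0 Z; rewrite addr0 => /eqP.
by rewrite -subr_eq0 opprD addNKr oppr_eq0 => /eqP.
Qed.

Lemma connectionZl f X Z : D (f *: X) Z = f *: D X Z.
Proof. by have := connection_linearl D f X 0 Z; rewrite connection0l !addr0. Qed.

Lemma connectionNl X Z : D (- X) Z = - D X Z.
Proof. by rewrite -scaleN1r connectionZl scaleN1r. Qed.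

Lemma curvatureC X Y Z : curvature D Y X Z = - curvature D X Y Z.
Proof. by rewrite /curvature bracketC connectionNl opprK !opprB addrC. Qed.

Lemma curvature_linear1 f X Y Z V :
  curvature D (f *: X + Y) Z V = f *: curvature D X Z V + curvature D Y Z V.
Proof.
rewrite /curvature bracket_linearl !connectionDl connectionNl !connectionZl.
rewrite connection_additiver connection_leibniz.
apply: vfield_eqP => h p.
rewrite !(vfieldD_val, vfieldN_val, vfieldZ_val); ring.
Qed.

Lemma curvature_linear2 f X Y Z V :
  curvature D Z (f *: X + Y) V = f *: curvature D Z X V + curvature D Z Y V.
Proof.
by rewrite !(curvatureC _ Z) curvature_linear1 opprD scalerN.
Qed.

Lemma curvature_linear3 f X Y Z V :
  curvature D X Y (f *: Z + V) = f *: curvature D X Y Z + curvature D X Y V.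
Proof.
rewrite /curvature !(connection_additiver, connection_leibniz).
apply: vfield_eqP => h p.
rewrite !(vfieldD_val, vfieldN_val, vfieldZ_val).
rewrite -[bracket X Y f p]/(X (Y f) p - Y (X f) p); ring.
Qed.

Definition tensorial4 (Q : vfield M -> vfield M -> vfield M -> vfield M -> Cinf M) :=
  [/\ forall Y Z V, tensorial1 (fun X => Q X Y Z V),
      forall X Z V, tensorial1 (fun Y => Q X Y Z V),
      forall X Y V, tensorial1 (fun Z => Q X Y Z V) &
      forall X Y Z, tensorial1 (fun V => Q X Y Z V)].

Variable g : semiRiemannianMetric M.

Lemma Rm_tensorial : tensorial4 (Rm g D).
Proof.
split=> [Y Z V f X W|X Z V f Y W|X Y V f Z W|X Y Z f V W]; rewrite /Rm.
- by rewrite curvature_linear1 tensor02_linearl.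
- by rewrite curvature_linear2 tensor02_linearl.
- by rewrite curvature_linear3 tensor02_linearl.
- by rewrite tensor02_linearr.
Qed.

Lemma tensorial4_slice Q Y Z : tensorial4 Q -> tensorial2 (fun X V => Q X Y Z V).
Proof. by case=> Q1 _ _ Q4; split=> X; [exact: Q1|exact: Q4]. Qed.

Lemma tensorial2B S T : tensorial2 S -> tensorial2 T ->
  tensorial2 (fun X Y => S X Y - T X Y : Cinf M).
Proof.
move=> [S1 S2] [T1 T2]; split=> X f Y Z; apply: Cinf_eqP => p.
  rewrite (S1 X f Y Z) (T1 X f Y Z).
  rewrite !(CinfB, CinfD, CinfM); ring.
rewrite (S2 X f Y Z) (T2 X f Y Z).
rewrite !(CinfB, CinfD, CinfM); ring.
Qed.

Lemma trace_gB S T : tensorial2 S -> tensorial2 T ->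
  trace_g g (fun X Y => S X Y - T X Y) = trace_g g S - trace_g g T.
Proof.
move=> tS tT; apply: Cinf_eqP => p; rewrite CinfB !trace_gE //; last exact: tensorial2B.
by rewrite -sumrB; apply: eq_bigr => i _; rewrite CinfB mulrBr.
Qed.

Lemma eq_trace_g S T : (forall X Y, S X Y = T X Y) -> trace_g g S = trace_g g T.
Proof. by move=> ST; congr trace_g; apply/funext => X; apply/funext => Y. Qed.

Hypothesis gD : metric_connection g D.

(** The two free slots are differentiated alike on both sides, which reduces
    the claim to [trace_cov_deriv2] for the two contracted slots. *)
Lemma trace_cov_deriv4 Q W Y Z : tensorial4 Q ->
  cov_deriv2 D (fun Y Z => trace_g g (fun X V => Q X Y Z V)) W Y Z =
  trace_g g (fun X V => cov_deriv4 D Q W X Y Z V).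
Proof.
move=> tQ; have sQ Y' Z' := tensorial4_slice Y' Z' tQ.
rewrite /cov_deriv2 -(trace_cov_deriv2 gD W (sQ Y Z)).
have tc := cov_deriv2_tensorial D W (sQ Y Z).
rewrite -trace_gB // -trace_gB //; last exact: tensorial2B.
apply: eq_trace_g => X V; rewrite /cov_deriv2 /cov_deriv4.
apply: Cinf_eqP => p; rewrite !(CinfB, CinfN); ring.
Qed.

Lemma ricci_tensorial : tensorial2 (ricci g D).
Proof.
have tR := Rm_tensorial; have sR Y Z := tensorial4_slice Y Z tR.
case: (tR) => _ R2 R3 _.
split=> [Y f X Z|X f Y Z]; apply: Cinf_eqP => p;
  rewrite CinfD CinfM /ricci !trace_gE // mulr_sumr -big_split;
  apply: eq_bigr => i _ /=.
  by rewrite R2 CinfD CinfM; ring.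
by rewrite R3 CinfD CinfM; ring.
Qed.

(** Computes every contraction in which one of the factors is the metric. *)
Lemma orthonormal_expand p (A : vfield M -> Cinf M) Y : tensorial1 A ->
  let e := orthonormal_basis g p in
  \sum_(i < n) g (e i) (e i) p * (g Y (e i) p * A (e i) p) = A Y p.
Proof.
move=> tA e; have [E [x fr]] := frame_exists p.
(* the sum is the trace of the tensor product of [g Y] and [A] *)
pose T X V : Cinf M := g Y X * A V.
have tT : tensorial2 T.
  split=> [V f X Z|X f V Z]; rewrite /T; apply: Cinf_eqP => q.
    by rewrite tensor02_linearr !(CinfM, CinfD); ring.
  by rewrite tA !(CinfM, CinfD); ring.
have := gram_trace g tT fr; rewrite -/e /T => H.
transitivity (\sum_(i < n) g (e i) (e i) p * (g Y (e i) * A (e i)) p) => //.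
rewrite H.
pose a : 'rV[R]_n := \row_k A (E k) p.
have -> : frame_mx E p (fun X V => g Y X * A V) = frame_mx E p g *m (coords x p Y)^T *m a.
  apply/matrixP => k l; rewrite !mxE big_ord1 !mxE CinfM; congr (_ * _).
  have [_ g2] := tensor02_tensorial g.
  have [g1 _] := tensor02_tensorial g.
  rewrite (frame_expand (g1 (E k)) Y fr); apply: eq_bigr => j _.
  by rewrite !mxE Defs.metric_sym mulrC.
rewrite -!mulmxA (mulKmx (gram_unit g fr)) mxtrace_mulC /mxtrace big_ord1 mxE.
by rewrite (frame_expand tA Y fr); apply: eq_bigr => k _; rewrite !mxE mulrC.
Qed.

Lemma orthonormal_dim p : let e := orthonormal_basis g p in
  \sum_(i < n) g (e i) (e i) p * g (e i) (e i) p = n%:R.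
Proof.
move=> e; rewrite -[n in RHS]card_ord -sumr_const; apply: eq_bigr => i _.
by apply: norm1_sqr; have := orthonormal_basisP g p i i; rewrite eqxx.
Qed.

End CurvatureTensor.

(** * The quasi-conformal curvature tensor and its contraction *)

Section QuasiConformal.
Variables (R : realType) (n : nat) (M : smoothManifold R n).
Implicit Types (p q : M) (f h : Cinf M) (X Y Z U V W : vfield M).
Variables (g : semiRiemannianMetric M) (D : linearConnection M) (a b : R).
Hypothesis gD : metric_connection g D.

Local Notation S := (ricci g D).
Local Notation r := (scalar_curvature g D).
Local Notation E := (einstein_tensor g D).
Local Notation C := (quasi_conformal g D a b).
Local Notation Rm := (Rm g D).

Lemma quasi_conformal_at X Y Z V p : C X Y Z V p =
  a * Rm X Y Z V p + b * (S Y Z p * g X V p - S X Z p * g Y V p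
     + g Y Z p * S X V p - g X Z p * S Y V p)
  - (n%:R^-1 * (a / (n%:R - 1) + 2 * b)) *
     (r p * (g Y Z p * g X V p - g X Z p * g Y V p)).
Proof. by []. Qed.

Lemma einstein_at X Y p : E X Y p = S X Y p - n%:R^-1 * (r p * g X Y p).
Proof. by []. Qed.

Lemma quasi_conformal_tensorial : tensorial4 C.
Proof.
have [R1 R2 R3 R4] := Rm_tensorial D g.
have [S1 S2] := ricci_tensorial D g.
have [g1 g2] := tensor02_tensorial g.
have R1' f X W Y Z V : Rm (f *: X + W) Y Z V = f * Rm X Y Z V + Rm W Y Z V := R1 Y Z V f X W.
have R2' f X W Y Z V : Rm Y (f *: X + W) Z V = f * Rm Y X Z V + Rm Y W Z V := R2 Y Z V f X W.
have R3' f X W Y Z V : Rm Y Z (f *: X + W) V = f * Rm Y Z X V + Rm Y Z W V := R3 Y Z V f X W.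
have R4' f X W Y Z V : Rm Y Z V (f *: X + W) = f * Rm Y Z V X + Rm Y Z V W := R4 Y Z V f X W.
have S1' f X W Y : S (f *: X + W) Y = f * S X Y + S W Y := S1 Y f X W.
have S2' f X W Y : S Y (f *: X + W) = f * S Y X + S Y W := S2 Y f X W.
have g1' f X W Y : g (f *: X + W) Y = f * g X Y + g W Y := g1 Y f X W.
have g2' f X W Y : g Y (f *: X + W) = f * g Y X + g Y W := g2 Y f X W.
split=> [Y Z V f X W|X Z V f Y W|X Y V f Z W|X Y Z f V W]; apply: Cinf_eqP => p.
- rewrite -[RHS]/(f p * C X Y Z V p + C W Y Z V p) !quasi_conformal_at.
  by rewrite R1' !S1' !g1' !(CinfD, CinfM); ring.
- rewrite -[RHS]/(f p * C X Y Z V p + C X W Z V p) !quasi_conformal_at.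
  by rewrite R2' !S1' !g1' !(CinfD, CinfM); ring.
- rewrite -[RHS]/(f p * C X Y Z V p + C X Y W V p) !quasi_conformal_at.
  by rewrite R3' !S2' !g2' !(CinfD, CinfM); ring.
- rewrite -[RHS]/(f p * C X Y Z V p + C X Y Z W p) !quasi_conformal_at.
  by rewrite R4' !S2' !g2' !(CinfD, CinfM); ring.
Qed.

Lemma einstein_tensorial : tensorial2 E.
Proof.
have [S1 S2] := ricci_tensorial D g.
have [g1 g2] := tensor02_tensorial g.
split=> [Y f X Z|X f Y Z]; apply: Cinf_eqP => p.
  rewrite -[RHS]/(f p * E X Y p + E Z Y p) !einstein_at.
  by rewrite (S1 Y f X Z) (g1 Y f X Z) !(CinfD, CinfM); ring.
rewrite -[RHS]/(f p * E X Y p + E X Z p) !einstein_at.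
by rewrite (S2 X f Y Z) (g2 X f Y Z) !(CinfD, CinfM); ring.
Qed.

(** The coefficients of the quasi-conformal tensor are tuned so that its Ricci
    contraction is proportional to the trace free part of the Ricci tensor. *)
Lemma trace_quasi_conformal Y Z : (2 < n)%N ->
  trace_g g (fun X V => C X Y Z V) = (a + (n%:R - 2) * b) *: E Y Z.
Proof.
move=> n2; apply: Cinf_eqP => p.
rewrite trace_gE; last exact: tensorial4_slice quasi_conformal_tensorial.
set e := orthonormal_basis g p.
have [S1 S2] := ricci_tensorial D g.
have [g1 g2] := tensor02_tensorial g.
have gC U V : g U V p = g V U p by rewrite Defs.metric_sym.
have tr1 : \sum_i g (e i) (e i) p * Rm (e i) Y Z (e i) p = S Y Z p.
  by rewrite /ricci trace_gE //; exact: tensorial4_slice (Rm_tensorial D g).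
have tr2 := orthonormal_expand g p Y (S1 Z).
have tr3 : \sum_i g (e i) (e i) p * S (e i) (e i) p = r p.
  by rewrite /scalar_curvature trace_gE //; exact: ricci_tensorial.
have tr4 := orthonormal_expand g p Z (S2 Y).
have tr5 := orthonormal_expand g p Y (g1 Z).
have tr6 := orthonormal_dim g p.
rewrite -/e in tr2 tr4 tr5 tr6.
transitivity (\sum_i (a * (g (e i) (e i) p * Rm (e i) Y Z (e i) p)
  + b * (S Y Z p * (g (e i) (e i) p * g (e i) (e i) p)
    - g (e i) (e i) p * (g Y (e i) p * S (e i) Z p)
    + g Y Z p * (g (e i) (e i) p * S (e i) (e i) p)
    - g (e i) (e i) p * (g Z (e i) p * S Y (e i) p))
  - (n%:R^-1 * (a / (n%:R - 1) + 2 * b)) * r p *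
     (g Y Z p * (g (e i) (e i) p * g (e i) (e i) p)
     - g (e i) (e i) p * (g Y (e i) p * g (e i) Z p)))).
  apply: eq_bigr => i _; rewrite quasi_conformal_at (gC Z (e i)); ring.
rewrite sumrB big_split /= -!mulr_sumr sumrB big_split sumrB /= -!mulr_sumr.
rewrite sumrB -!mulr_sumr tr1 tr2 tr3 tr4 tr5 tr6.
rewrite -[RHS]/((a + (n%:R - 2) * b) * (S Y Z p - n%:R^-1 * (r p * g Y Z p))).
have n0 : n%:R != 0 :> R by rewrite pnatr_eq0; case: (n) n2.
have n1 : n%:R - 1 != 0 :> R.
  by rewrite subr_eq0 -[1]/(1%:R) eqr_nat; case: (n) n2 => [|[|]].
by field; rewrite n0 n1.
Qed.

Lemma trace_einstein : (0 < n)%N -> trace_g g E = 0.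
Proof.
move=> n0; apply: Cinf_eqP => p; rewrite trace_gE; last exact: einstein_tensorial.
set e := orthonormal_basis g p.
have tr3 : \sum_i g (e i) (e i) p * S (e i) (e i) p = r p.
  by rewrite /scalar_curvature trace_gE //; exact: ricci_tensorial.
have tr6 := orthonormal_dim g p.
rewrite -/e in tr6.
transitivity (\sum_i (g (e i) (e i) p * S (e i) (e i) p -
   n%:R^-1 * r p * (g (e i) (e i) p * g (e i) (e i) p))).
  by apply: eq_bigr => i _; rewrite einstein_at; ring.
rewrite sumrB -mulr_sumr tr3 tr6 mulrAC mulVf ?mul1r ?subrr //.
by rewrite pnatr_eq0 -lt0n.
Qed.

Lemma trace_cov_einstein U : (0 < n)%N -> trace_g g (cov_deriv2 D E U) = 0.
Proof.
move=> n0; rewrite (trace_cov_deriv2 gD U einstein_tensorial) trace_einstein //.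
by apply: Cinf_eqP => p; exact: vfield0_at.
Qed.

Lemma cov_einstein_at U X Y p : cov_deriv2 D E U X Y p =
  cov_deriv2 D S U X Y p - n%:R^-1 * (U r p * g X Y p).
Proof.
rewrite -[LHS]/(U (E X Y) p - E (D U X) Y p - E X (D U Y) p).
rewrite -[cov_deriv2 D S U X Y p]/(U (S X Y) p - S (D U X) Y p - S X (D U Y) p).
rewrite !einstein_at.
have -> : U (E X Y) p = U (S X Y) p - n%:R^-1 * (U r p * g X Y p + r p * U (g X Y) p).
  by rewrite vfieldB_at vfieldZ_at vfieldM_at.
have := congr1 (fun f : Cinf M => f p) (gD U X Y).
rewrite /cov_deriv2 !CinfB Cinf0 => /eqP; rewrite subr_eq0 subr_eq => /eqP ->.
ring.
Qed.

(** Contracting the vanishing derivative of the quasi-conformal tensor leaves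
    this number times the derivative of the Einstein tensor. *)
Lemma quasi_conformally_symmetric_coef : (2 < n)%N ->
  quasi_conformally_symmetric g D a b -> ~ parallel2 D E ->
  a + (n%:R - 2) * b = 0.
Proof.
move=> n2 qc nE; apply: contrapT => /eqP k0; apply: nE => U Y Z.
apply: Cinf_eqP => p; apply: (mulfI k0).
have := trace_cov_deriv4 gD U Y Z quasi_conformal_tensorial.
have -> : (fun X V => cov_deriv4 D C U X Y Z V) = (fun X V => 0).
  by apply/funext => X; apply/funext => V; rewrite qc.
have -> : trace_g g (fun _ _ => 0 : Cinf M) = 0.
  apply: Cinf_eqP => q; rewrite trace_gE; last by split=> ? ? ? ?; rewrite mulr0 addr0.
  by rewrite big1 // => i _; rewrite mulr0.
have -> : (fun Y Z => trace_g g (fun X V => C X Y Z V)) =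
    (fun Y Z => (a + (n%:R - 2) * b) *: E Y Z).
  by apply/funext => Y'; apply/funext => Z'; rewrite trace_quasi_conformal.
move/(congr1 (fun f : Cinf M => f p)); rewrite Cinf0 mulr0 => <-.
rewrite -[RHS]/(U ((a + (n%:R - 2) * b) *: E Y Z) p -
  (a + (n%:R - 2) * b) * E (D U Y) Z p - (a + (n%:R - 2) * b) * E Y (D U Z) p).
rewrite vfieldZ_at -!mulrBr; congr (_ * _).
Qed.

(** Only curvatures are differentiated, since the metric is parallel. *)
Lemma cov_quasi_conformal_at U X Y Z V p : cov_deriv4 D C U X Y Z V p =
  a * cov_deriv4 D Rm U X Y Z V p +
  b * (cov_deriv2 D S U Y Z p * g X V p - cov_deriv2 D S U X Z p * g Y V p
     + g Y Z p * cov_deriv2 D S U X V p - g X Z p * cov_deriv2 D S U Y V p)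
  - (n%:R^-1 * (a / (n%:R - 1) + 2 * b)) *
     (U r p * (g Y Z p * g X V p - g X Z p * g Y V p)).
Proof.
have gU X' Y' : U (g X' Y') p = g (D U X') Y' p + g X' (D U Y') p.
  have := congr1 (fun f : Cinf M => f p) (gD U X' Y').
  by rewrite /cov_deriv2 !CinfB Cinf0 => /eqP; rewrite subr_eq0 subr_eq addrC => /eqP.
rewrite -[LHS]/(U (C X Y Z V) p - C (D U X) Y Z V p - C X (D U Y) Z V p
  - C X Y (D U Z) V p - C X Y Z (D U V) p).
rewrite -[cov_deriv4 D Rm U X Y Z V p]/(U (Rm X Y Z V) p - Rm (D U X) Y Z V p
  - Rm X (D U Y) Z V p - Rm X Y (D U Z) V p - Rm X Y Z (D U V) p).
have SU X' Y' : cov_deriv2 D S U X' Y' p =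
  U (S X' Y') p - S (D U X') Y' p - S X' (D U Y') p by [].
rewrite !SU !quasi_conformal_at.
have -> : U (C X Y Z V) p = a * U (Rm X Y Z V) p +
   b * ((U (S Y Z) p * g X V p + S Y Z p * U (g X V) p) -
        (U (S X Z) p * g Y V p + S X Z p * U (g Y V) p) +
        (U (g Y Z) p * S X V p + g Y Z p * U (S X V) p) -
        (U (g X Z) p * S Y V p + g X Z p * U (S Y V) p)) -
   (n%:R^-1 * (a / (n%:R - 1) + 2 * b)) *
   (U r p * (g Y Z p * g X V p - g X Z p * g Y V p) +
    r p * ((U (g Y Z) p * g X V p + g Y Z p * U (g X V) p) -
           (U (g X Z) p * g Y V p + g X Z p * U (g Y V) p))).
  by rewrite vfieldB_at vfieldD_at !vfieldZ_at !(vfieldB_at, vfieldD_at, vfieldM_at).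
rewrite !gU; ring.
Qed.

End QuasiConformal.

(** * Parallel symmetric forms and the derivative of curvature *)

Section Invariance.
Variables (R : realType) (n : nat) (M : smoothManifold R n).
Implicit Types (p q : M) (f h : Cinf M) (X Y Z U V W : vfield M).
Variables (D : linearConnection M).

Definition cov_curvature U X Y Z : vfield M :=
  D U (curvature D X Y Z) - curvature D (D U X) Y Z - curvature D X (D U Y) Z
  - curvature D X Y (D U Z).

Section ParallelForm.
Variable H : tensor02 M.
Hypothesis HD : parallel2 D H.

Lemma parallel_deriv U X Y : U (H X Y) = H (D U X) Y + H X (D U Y).
Proof.
apply: Cinf_eqP => p; rewrite CinfD.
have E : U (H X Y) p - H (D U X) Y p - H X (D U Y) p = 0.
  by have := congr1 (fun f : Cinf M => f p) (HD U X Y); rewrite /cov_deriv2 !CinfB.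
lra.
Qed.

Lemma tensor02B1 X Y Z p : H (X - Y) Z p = H X Z p - H Y Z p.
Proof.
have [H1 _] := tensor02_tensorial H.
have := tensorialD (H1 Z) X (- Y); rewrite /= => ->.
by have := tensorialN (H1 Z) Y; rewrite /= => ->.
Qed.

Lemma tensor02B2 X Y Z p : H Z (X - Y) p = H Z X p - H Z Y p.
Proof.
have [_ H2] := tensor02_tensorial H.
by rewrite (tensorialD (H2 Z)) (tensorialN (H2 Z)).
Qed.

Lemma tensor02B1_4 X1 X2 X3 X4 Z p : H (X1 - X2 - X3 - X4) Z p =
  H X1 Z p - H X2 Z p - H X3 Z p - H X4 Z p.
Proof. by rewrite !tensor02B1. Qed.

Lemma tensor02B2_4 X1 X2 X3 X4 Z p : H Z (X1 - X2 - X3 - X4) p =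
  H Z X1 p - H Z X2 p - H Z X3 p - H Z X4 p.
Proof. by rewrite !tensor02B2. Qed.

(** The curvature acts on tensors as a commutator of covariant derivatives, each
    of which kills [H]. *)
Lemma curvature_invariance X Y Z V p :
  H (curvature D X Y Z) V p + H Z (curvature D X Y V) p = 0.
Proof.
have E1 : X (Y (H Z V)) p = H (D X (D Y Z)) V p + H (D Y Z) (D X V) p +
    (H (D X Z) (D Y V) p + H Z (D X (D Y V)) p).
  by rewrite parallel_deriv vfieldD_at !parallel_deriv.
have E2 : Y (X (H Z V)) p = H (D Y (D X Z)) V p + H (D X Z) (D Y V) p +
    (H (D Y Z) (D X V) p + H Z (D Y (D X V)) p).
  by rewrite parallel_deriv vfieldD_at !parallel_deriv.
have E3 : X (Y (H Z V)) p - Y (X (H Z V)) p =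
    H (D (bracket X Y) Z) V p + H Z (D (bracket X Y) V) p.
  by rewrite -[LHS]/(bracket X Y (H Z V) p) parallel_deriv.
rewrite /curvature !tensor02B1 !tensor02B2; lra.
Qed.

(** Differentiate [curvature_invariance] along [U]; the terms where [U] acts on
    one of the arguments are instances of the same identity. *)
Lemma cov_curvature_invariance U X Y Z V p :
  H (cov_curvature U X Y Z) V p + H Z (cov_curvature U X Y V) p = 0.
Proof.
have F : {near p, (H (curvature D X Y Z) V + H Z (curvature D X Y V)) =1 (0 : Cinf M)}.
  by near=> q; rewrite CinfD curvature_invariance.
have := vfield_local U F; rewrite vfield0_at vfieldD_at !parallel_deriv !CinfD => E1.
have E2 := curvature_invariance (D U X) Y Z V p.
have E3 := curvature_invariance X (D U Y) Z V p.
have E4 := curvature_invariance X Y (D U Z) V p.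
have E5 := curvature_invariance X Y Z (D U V) p.
rewrite tensor02B1_4 tensor02B2_4; lra.
Unshelve. all: by end_near. Qed.

End ParallelForm.

Variables (g : semiRiemannianMetric M) (a b : R).
Hypothesis gD : metric_connection g D.

Lemma cov_curvature_Rm U X Y Z V p :
  g (cov_curvature U X Y Z) V p = cov_deriv4 D (Rm g D) U X Y Z V p.
Proof.
rewrite tensor02B1_4 /cov_deriv4 /Rm.
rewrite (parallel_deriv gD U (curvature D X Y Z) V) !CinfB CinfD; ring.
Qed.

Lemma bform_eq0 (A : 'M[R]_n) : (forall z w, bform A z w = 0) -> A = 0.
Proof.
move=> H; apply/matrixP => k l; rewrite [RHS]mxE -(H (delta_mx 0 k) (delta_mx 0 l)).
by rewrite /bform -rowE trmx_delta -colE !mxE.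
Qed.

Lemma bform_sprod (P Q z w : 'rV[R]_n) : bform (sprod P Q) z w =
  (P *m z^T) 0 0 * (Q *m w^T) 0 0 + (Q *m z^T) 0 0 * (P *m w^T) 0 0.
Proof.
rewrite /bform -[z in LHS]trmxK sprod_col mulmxDl mxE -!scalemxAl !mxE.
by [].
Qed.

(** When the quasi-conformal tensor is parallel, the derivative of the curvature
    along [U] at [p] is the operator x /\ by + bx /\ y, for [B] the combination
    of [g] and of the derivative of the Ricci tensor below.  The form [B] is not
    a multiple of [g], for otherwise the derivative of the Einstein tensor would
    be one too, and it would vanish since its trace does. *)
Lemma parallel_form_determined p U X0 Y0 : (2 < n)%N -> b != 0 ->
  quasi_conformally_symmetric g D a b -> a + (n%:R - 2) * b = 0 ->
  cov_deriv2 D (einstein_tensor g D) U X0 Y0 p <> 0 ->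
  exists E (v u u' : 'rV[R]_n), forall H, SQFI D H ->
    v *m frame_mx E p H = 0 -> u *m frame_mx E p H *m u'^T = 0 -> forall X Y, H X Y p = 0.
Proof.
move=> n2 b0 qc ab nE.
have n0 : (0 < n)%N by exact: ltnW (ltnW n2).
have n2R : n%:R - 2 != 0 :> R.
  by rewrite subr_eq0 eqr_nat gtn_eqF.
have nR0 : n%:R != 0 :> R by rewrite pnatr_eq0 -lt0n.
(* [n > 2] and [b != 0] give [a != 0], so that the derivative of the
   curvature can be solved for *)
have a0 : a != 0.
  have -> : a = - ((n%:R - 2) * b) by apply/eqP; rewrite -addr_eq0 ab.
  by rewrite oppr_eq0 mulf_neq0.
have [E [x fr]] := frame_exists p.
pose G := frame_mx E p g.
have uG := gram_unit g fr; have Gs := gram_sym g p E; rewrite -/G in uG Gs.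
pose S := ricci g D; pose r := scalar_curvature g D.
have tS := ricci_tensorial D g; have tdS := cov_deriv2_tensorial D U tS.
(* [k2] is halved because a multiple of [g] in [B] contributes twice to the
   operator x /\ by + bx /\ y *)
pose k1 := - b / a.
pose k2 := n%:R^-1 * (a / (n%:R - 1) + 2 * b) * U r p / (2 * a).
pose B := k1 *: frame_mx E p (cov_deriv2 D S U) + k2 *: G.
have gE X Y : g X Y p = bform G (coords x p X) (coords x p Y).
  exact: frame_expand2 (tensor02_tensorial g) fr.
have BE X Y : bform B (coords x p X) (coords x p Y) =
    k1 * cov_deriv2 D S U X Y p + k2 * g X Y p.
  rewrite gE (frame_expand2 _ _ tdS fr) /bform /B mulmxDr mulmxDl -!scalemxAr -!scalemxAl.
  by rewrite !mxE.
have RmE X Y Z V : cov_deriv4 D (Rm g D) U X Y Z V p =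
    bform B (coords x p Y) (coords x p Z) * g X V p
    - bform B (coords x p X) (coords x p Z) * g Y V p
    + g Y Z p * bform B (coords x p X) (coords x p V)
    - g X Z p * bform B (coords x p Y) (coords x p V).
  have := cov_quasi_conformal_at a b gD U X Y Z V p; rewrite qc Cinf0 -/S -/r.
  set c := n%:R^-1 * _ => H; rewrite !BE.
  apply: (mulfI a0).
  have -> : k2 = c * U r p / (2 * a) by [].
  rewrite /k1; move: H; set dR := cov_deriv4 _ _ _ _ _ _ _ _ => H.
  transitivity (c * (U r p * (g Y Z p * g X V p - g X Z p * g Y V p)) - b *
    (cov_deriv2 D S U Y Z p * g X V p - cov_deriv2 D S U X Z p * g Y V p +
     g Y Z p * cov_deriv2 D S U X V p - g X Z p * cov_deriv2 D S U Y V p)).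
    by move: H; lra.
  by field; rewrite a0.
have Bnot c : B <> c *: G.
  move=> BG; apply: nE.
  have k10 : k1 != 0 by rewrite /k1 mulf_neq0 ?oppr_eq0 ?invr_eq0.
  pose m := (c - k2) / k1 - n%:R^-1 * U r p.
  have tE := cov_deriv2_tensorial D U (einstein_tensorial g D).
  have EG X Y : cov_deriv2 D (einstein_tensor g D) U X Y p = m * g X Y p.
    rewrite (cov_einstein_at gD) -/S -/r; apply: (mulfI k10).
    have := BE X Y; rewrite BG.
    have -> : bform (c *: G) (coords x p X) (coords x p Y) = c * g X Y p.
      by rewrite gE /bform -scalemxAr -scalemxAl mxE.
    move=> H; have -> : cov_deriv2 D S U X Y p = (c * g X Y p - k2 * g X Y p) / k1.
      by rewrite H addrK mulrC mulKf.
    rewrite /m; field; by rewrite k10 nR0.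
  have m0 : m = 0.
    have := congr1 (fun f : Cinf M => f p) (trace_cov_einstein gD U n0).
    rewrite (trace_gE g p tE) (gram_trace g tE fr) Cinf0.
    have -> : frame_mx E p (cov_deriv2 D (einstein_tensor g D) U) = m *: G.
      by apply/matrixP => k l; rewrite [LHS]mxE EG !mxE.
    rewrite -scalemxAr mulVmx // mxtraceZ mxtrace1 => /eqP.
    by rewrite mulf_eq0 pnatr_eq0 (gtn_eqF n0) orbF => /eqP.
  by rewrite EG m0 mul0r.
have [v [u [u' det]]] := invariant_form_determined n2 Gs uG Bnot.
exists E, v, u, u' => H [Hs HD] vH uH.
have tH := tensor02_tensorial H.
suff H0 : frame_mx E p H = 0.
  by move=> X Y; rewrite (frame_expand2 _ _ tH fr) H0 /bform mulmx0 mul0mx mxE.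
apply: det vH uH; first by apply/matrixP => k l; rewrite !mxE Hs.
move=> y z; apply: bform_eq0 => w t.
(* the value at [w] of the operator y /\ bz + by /\ z *)
pose d y z w := bform B z w *: y - bform B y w *: z
   + bform G z w *: (y *m B *m invmx G) - bform G y w *: (z *m B *m invmx G).
have dE w' : coords x p (cov_curvature U (frame_vec E y) (frame_vec E z) (frame_vec E w')) = d y z w'.
  apply/eqP; rewrite -subr_eq0; apply/eqP; apply: (bform_nondegenerate uG) => t'.
  rewrite bformDl bformNl.
  have := cov_curvature_Rm U (frame_vec E y) (frame_vec E z) (frame_vec E w') (frame_vec E t') p.
  rewrite RmE !gE !(coords_vec _ fr) => ->.
  rewrite /d !bformDl !bformNl !bformZl.
  have bG s : bform G (s *m B *m invmx G) t' = bform B s t' by rewrite /bform mulmxKV.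
  rewrite !bG; ring.
have := cov_curvature_invariance HD U (frame_vec E y) (frame_vec E z) (frame_vec E w) (frame_vec E t) p.
rewrite !(frame_expand2 _ _ tH fr) !dE !(coords_vec _ fr).
set Hm := frame_mx E p H.
have HmC s s' : bform Hm s s' = bform Hm s' s.
  by apply: bformC; apply/matrixP => k l; rewrite !mxE Hs.
rewrite (HmC w) /d !bformDl !bformNl !bformZl => E1.
have SP A A' s s' : bform (sprod (s *m A) (s' *m A')) w t =
  bform A s w * bform A' s' t + bform A' s' w * bform A s t by exact: bform_sprod.
have bN (A A' : 'M[R]_n) s s' : bform (A - A') s s' = bform A s s' - bform A' s s'.
  by rewrite /bform mulmxBr mulmxBl !mxE.
have bD (A A' : 'M[R]_n) s s' : bform (A + A') s s' = bform A s s' + bform A' s s'.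
  by rewrite /bform mulmxDr mulmxDl mxE.
rewrite !bN bD !bN !SP; lra.
Qed.

End Invariance.

(** * Unique continuation of parallel tensors *)

Section LinearSystem.
Variables (R : realType) (n : nat).

(** On a small enough box let [c] be a point where the sum of the [`|F i|] is
    largest.  The mean value theorem between [u] and [c] bounds this maximum by
    half of itself. *)
Lemma linear_system_zero (I : finType) (F : I -> 'rV[R]_n -> R) (u : 'rV[R]_n) (r C : R) :
  0 < r ->
  (forall i y, `|y - u| < r -> {for y, continuous (F i)}) ->
  (forall i y k, `|y - u| < r -> derivable (F i) y (delta_mx 0 k)) ->
  (forall i y k, `|y - u| < r ->
    `|'D_(delta_mx 0 k) (F i) y| <= C * \sum_j `|F j y|) ->
  (forall i, F i u = 0) ->
  exists2 s : R, 0 < s & forall i y, `|y - u| < s -> F i y = 0.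
Proof.
move=> r0 cF dF DF F0.
pose N : R := #|I|%:R * n%:R * `|C|.
have N0 : 0 <= N by rewrite /N !mulr_ge0.
(* chosen so that [N * s <= 1 / 2], where [N] collects the constants of the
   mean value estimate *)
pose s : R := Num.min (r / 2) (2^-1 / (N + 1)).
have N1 : 0 < N + 1 by rewrite ltr_wpDl.
have s0 : 0 < s by rewrite lt_min !divr_gt0 ?invr_gt0.
have sr : s < r.
  by apply: (@le_lt_trans _ _ (r / 2)); [rewrite ge_min lexx|lra].
have sN : N * s <= 2^-1.
  apply: (@le_trans _ _ ((N + 1) * (2^-1 / (N + 1)))).
    by apply: ler_pM => //; [exact: ltW|rewrite lerDl|rewrite ge_min lexx orbT].
  by rewrite mulrC divfK // gt_eqF.
pose S y : R := \sum_i `|F i y|.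
have S0 y : 0 <= S y by apply: sumr_ge0.
have [||c] := @EVT_max_rV R n S _ _ (@compact_box R n u s).
- by exists u; rewrite /= subrr normr0 ltW.
- apply: continuous_in_subspaceT => y; rewrite inE /= => ys.
  apply: (cvg_big (op := +%R) _ (nbhs_filter y)); first exact: add_continuous.
  move=> i _; apply: (@continuous_comp _ _ _ (F i) (fun t => `|t|)).
    by apply: cF; exact: le_lt_trans sr.
  exact: norm_continuous.
rewrite inE /= => cs cmax.
have Fc i : `|F i c| <= n%:R * `|C| * s * S c.
  have dF' y : `|y - u| <= s -> forall k, derivable (F i) y (delta_mx 0 k).
    by move=> ys k; apply: dF; exact: le_lt_trans sr.
  have [d dc E] := mvt_coord dF' cs.
  rewrite F0 subr0 in E; rewrite E; apply: le_trans (ler_norm_sum _ _ _) _.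
  have -> : n%:R * `|C| * s * S c = \sum_(k < n) (`|C| * S c * s).
    by rewrite sumr_const card_ord -mulr_natl; ring.
  apply: ler_sum => k _; rewrite normrM; apply: ler_pM => //.
    have ds : `|d k - u| <= s by apply: le_trans (dc k) cs.
    apply: le_trans (DF i _ k (le_lt_trans ds sr)) _.
    apply: (@le_trans _ _ (`|C| * S (d k))).
      by rewrite ler_wpM2r ?S0 // ler_norm.
    by rewrite ler_wpM2l // cmax // inE.
  by apply: le_trans cs; have := rV_coord_le (c - u) k; rewrite !mxE.
have Sc : S c = 0.
  have : S c <= N * s * S c.
    apply: le_trans (ler_sum _ (fun i _ => Fc i)) _.
    by rewrite sumr_const -mulr_natl /N cardT -cardE; lra.
  have := S0 c; have : N * s * S c <= 2^-1 * S c by rewrite ler_wpM2r.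
  lra.
exists s => // i y ys.
have : S y = 0.
  by apply/eqP; rewrite eq_le S0 andbT -Sc cmax // inE /= ltW.
by move/psumr_eq0P => /(_ (fun _ _ => normr_ge0 _) i isT) /normr0_eq0.
Qed.

Lemma pair_sum_ge (a : 'I_n * 'I_n -> R) : (forall t, 0 <= a t) ->
  (forall k, \sum_m a (k, m) <= \sum_t a t) /\ (forall l, \sum_m a (m, l) <= \sum_t a t).
Proof.
move=> a0; have -> : \sum_t a t = \sum_k \sum_l a (k, l).
  by rewrite pair_bigA; apply: eq_bigr => -[].
split=> [k|l].
  by rewrite [leRHS](bigD1 k) //= lerDl; apply: sumr_ge0 => j _; exact: sumr_ge0.
by apply: ler_sum => k _; rewrite (bigD1 l) //= lerDl; exact: sumr_ge0.
Qed.

End LinearSystem.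

Section UniqueContinuation.
Variables (R : realType) (n : nat) (M : smoothManifold R n).
Implicit Types (p q : M) (f h : Cinf M) (X Y Z U V W : vfield M).
Variables (D : linearConnection M) (H : tensor02 M).
Hypothesis HD : parallel2 D H.

Lemma Cinf_continuous f p : {for p, continuous f}.
Proof.
have [i ip] := chart_cover M p.
have ci := smooth_on_continuous (Cinf_smooth f i) (chart_codom ip).
have cc := chart_continuous i p ip.
have H1 : {for p, continuous ((f \o chart_inv i) \o chart i)} by apply: continuous_comp.
have E : {near p, (f \o chart_inv i) \o chart i =1 f}.
  have : nbhs p (chart_dom i).
    by apply: open_nbhs_nbhs; split => //; exact: open_chart_dom.
  by apply: filterS => q iq /=; rewrite chartK.
rewrite /prop_for /continuous_at -(nbhs_singleton E).
apply: cvg_trans H1; exact: near_eq_cvg.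
Qed.

(** In a frame, the components of a parallel tensor satisfy a homogeneous linear
    total differential system, whose coefficients are the Christoffel symbols. *)
Lemma parallel_zero_near p : (forall X Y, H X Y p = 0) ->
  \forall q \near p, forall X Y, H X Y q = 0.
Proof.
move=> H0.
have [i [E [x frm]]] := local_frame p.
have tH := tensor02_tensorial H; have [H1 H2] := tH.
pose G j k m : Cinf M := D (E j) (E k) (x m).
pose C : R := \sum_(t : 'I_n * 'I_n * 'I_n) (`|G t.1.1 t.1.2 t.2 p| + 1).
have C0 : 0 <= C by apply: sumr_ge0 => t _; rewrite addr_ge0.
have GC : \forall q \near p, forall j k m, `|G j k m q| <= C.
  have N (t : 'I_n * 'I_n * 'I_n) : \forall q \near p, `|G t.1.1 t.1.2 t.2 q| <= C.
    have : {for p, continuous (G t.1.1 t.1.2 t.2)} by exact: Cinf_continuous.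
    move/cvgrPdist_le => /(_ 1 ltr01).
    apply: filterS => q Gq.
    apply: (@le_trans _ _ (`|G t.1.1 t.1.2 t.2 p| + 1)).
      rewrite -(subrK (G t.1.1 t.1.2 t.2 p) (G t.1.1 t.1.2 t.2 q)) addrC.
      by apply: le_trans (ler_normD _ _) _; rewrite lerD2l distrC.
    by rewrite /C (bigD1 t) //= lerDl; apply: sumr_ge0 => j _; rewrite addr_ge0.
  have /filter_forall := N; apply: filterS => q Gq j k m.
  exact: (Gq (j, k, m)).
have ip : chart_dom i p by have [] := nbhs_singleton frm.
have fr q : (\forall q' \near q, [/\ chart_dom i q',
    forall k f, E k f q' = chart_deriv i k f q',
    forall k l, E k (x l) q' = (l == k)%:R &
    forall X f, X f q' = \sum_k X (x k) q' * E k f q']) -> is_frame q E x.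
  by apply: filterS => q' [].
have [r r0 rP] := near_chart_inv ip (filterI (nbhs_interior frm) GC).
pose F (t : 'I_n * 'I_n) := H (E t.1) (E t.2) \o chart_inv i.
have sF t k : Ck_on k (ball (chart i p) r) (F t).
  by apply: Ck_on_sub (Cinf_smooth _ i k) => y /rP[].
have [||||s s0 sP] := @linear_system_zero R n _ F (chart i p) r (2 * C) r0.
- by move=> t y /ball_normP yr; exact: smooth_on_continuous yr.
- by move=> t y k /ball_normP yr; exact: smooth_on_derivable yr.
- move=> [k l] y j /ball_normP /rP[yc [fq Gq]].
  set q := chart_inv i y in fq Gq.
  have [iq Eq _ _] := nbhs_singleton fq.
  have -> : 'D_(delta_mx 0 j) (F (k, l)) y = E j (H (E k) (E l)) q.
    by rewrite Eq /chart_deriv chart_invK.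
  rewrite (parallel_deriv HD) CinfD.
  rewrite (frame_expand (H1 _) _ (fr q fq)) (frame_expand (H2 _) _ (fr q fq)).
  have -> : 2 * C * (\sum_t `|F t y|) = C * (\sum_t `|F t y|) + C * (\sum_t `|F t y|) by lra.
  have [sumr suml] := pair_sum_ge (fun t => normr_ge0 (F t y)).
  apply: le_trans (ler_normD _ _) _; apply: lerD;
    apply: le_trans (ler_norm_sum _ _ _) _.
    apply: le_trans (ler_wpM2l C0 (suml l)); rewrite mulr_sumr.
    by apply: ler_sum => m _; rewrite normrM ler_wpM2r // Gq.
  apply: le_trans (ler_wpM2l C0 (sumr k)); rewrite mulr_sumr.
  by apply: ler_sum => m _; rewrite normrM ler_wpM2r // Gq.
- by move=> t; rewrite /F /= chartK.
have N := nbhsx_ballx (chart i p) s s0.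
apply: filterS3 (near_chart ip N) (nbhs_interior frm) GC => q [iq /ball_normP qs] fq _ X Y.
rewrite (frame_expand2 X Y tH (fr q fq)).
have -> : frame_mx E q H = 0.
  apply/matrixP => k l; rewrite !mxE; have := sP (k, l) _ qs.
  by rewrite /F /= chartK.
by rewrite /bform mulmx0 mul0mx mxE.
Qed.

(** The zero set of a parallel tensor is open and closed. *)
Lemma parallel_zero p : connected [set: M] -> (forall X Y, H X Y p = 0) ->
  forall q X Y, H X Y q = 0.
Proof.
move=> cM H0.
pose Z := [set q : M | forall X Y, H X Y q = 0].
suff ZT : Z = setT by move=> q; have : [set: M] q by []; rewrite -ZT.
apply: cM.
- by exists p.
- exists Z; last by rewrite setTI.
  rewrite openE => q Zq; exact: parallel_zero_near.
- exists Z; last by rewrite setTI.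
  rewrite -openC openE => q Zq.
  have [X [Y HXY]] : exists X Y, H X Y q != 0.
    apply: contrapT => N; apply: Zq => X Y; apply: contrapT => /eqP XY.
    by apply: N; exists X, Y.
  have c : {for q, continuous (H X Y)} by exact: Cinf_continuous.
  have : nbhs q [set q' | H X Y q' != 0].
    by apply: (c [set t | t != 0]); apply: open_nbhs_nbhs; split => //; exact: open_neq.
  by apply: filterS => q' /= h /(_ X Y) e; rewrite e eqxx in h.
Qed.

End UniqueContinuation.

(** * The index *)

Section Index.
Variables (R : realType) (n : nat) (M : smoothManifold R n).
Implicit Types (p q : M) (f h : Cinf M) (X Y Z U V W : vfield M).
Variables (D : linearConnection M).

Definition lincomb_fun l (c : 'I_l -> R) (H : 'I_l -> tensor02 M) X Y : Cinf M :=
  \sum_(i < l) c i *: H i X Y.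

Lemma lincomb_linearl l (c : 'I_l -> R) H f X Y Z :
  lincomb_fun c H (f *: X + Y) Z = f * lincomb_fun c H X Z + lincomb_fun c H Y Z.
Proof.
rewrite /lincomb_fun mulr_sumr -big_split; apply: eq_bigr => i _.
by apply: Cinf_eqP => p; rewrite tensor02_linearl !(CinfD, CinfM, CinfZ); ring.
Qed.

Lemma lincomb_linearr l (c : 'I_l -> R) H f X Y Z :
  lincomb_fun c H X (f *: Y + Z) = f * lincomb_fun c H X Y + lincomb_fun c H X Z.
Proof.
rewrite /lincomb_fun mulr_sumr -big_split; apply: eq_bigr => i _.
by apply: Cinf_eqP => p; rewrite tensor02_linearr !(CinfD, CinfM, CinfZ); ring.
Qed.

Definition lincomb l (c : 'I_l -> R) H := Tensor02 (lincomb_linearl c H) (lincomb_linearr c H).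

Lemma lincomb_at l (c : 'I_l -> R) H X Y p :
  lincomb c H X Y p = \sum_(i < l) c i * H i X Y p.
Proof. by rewrite /= /lincomb_fun Cinf_sum. Qed.

Lemma lincomb_SQFI l (c : 'I_l -> R) H : (forall i, SQFI D (H i)) -> SQFI D (lincomb c H).
Proof.
move=> HP; split=> [X Y|U X Y]; apply: Cinf_eqP => p.
  by rewrite !lincomb_at; apply: eq_bigr => i _; have [-> _] := HP i.
rewrite Cinf0 -[LHS]/(U (lincomb c H X Y) p - lincomb c H (D U X) Y p - lincomb c H X (D U Y) p).
rewrite !lincomb_at /= /lincomb_fun vfield_sum_at -!sumrB big1 // => i _.
have [_ Hi] := HP i.
by rewrite vfieldZ_at (parallel_deriv Hi) CinfD; ring.
Qed.

Definition independent l (H : 'I_l -> tensor02 M) :=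
  forall c : 'I_l -> R, (forall X Y, \sum_(i < l) c i *: H i X Y = 0) -> forall i, c i = 0.

(** The hypothesis says that [n + 1] linear functionals of the value at [p], the
    [n] entries of [v K] and the number [u K u'^T], detect whether a parallel
    symmetric form vanishes at [p].  By unique continuation they detect whether
    it vanishes everywhere, so they send independent forms to independent rows. *)
Lemma independent_bound p l (H : 'I_l -> tensor02 M) E (v u u' : 'rV[R]_n) :
  connected [set: M] -> (forall i, SQFI D (H i)) -> independent H ->
  (forall K, SQFI D K -> v *m frame_mx E p K = 0 -> u *m frame_mx E p K *m u'^T = 0 ->
    forall X Y, K X Y p = 0) ->
  (l <= n + 1)%N.
Proof.
move=> cM HS iH det.
pose L := \matrix_(i < l) row_mx (v *m frame_mx E p (H i)) (u *m frame_mx E p (H i) *m u'^T).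
suff /eqP <- : row_free L by exact: rank_leq_col.
rewrite -kermx_eq0; apply/rowV0P => c /sub_kermxP cL.
have matK : frame_mx E p (lincomb (fun i => c 0 i) H) = \sum_i c 0 i *: frame_mx E p (H i).
  apply/matrixP => k m; rewrite mxE lincomb_at summxE.
  by apply: eq_bigr => i _; rewrite !mxE.
have cL' : row_mx (v *m frame_mx E p (lincomb (fun i => c 0 i) H))
    (u *m frame_mx E p (lincomb (fun i => c 0 i) H) *m u'^T) = 0.
  have sum_row_mx (A : 'I_l -> 'rV[R]_n) (B : 'I_l -> 'rV[R]_1) :
      row_mx (\sum_i A i) (\sum_i B i) = \sum_i row_mx (A i) (B i).
    by elim/big_rec3: _ => [|i x y z _ <-]; rewrite ?row_mx0 // add_row_mx.
  rewrite -cL (mulmx_sum_row c) matK !mulmx_sumr mulmx_suml sum_row_mx.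
  by apply: eq_bigr => i _; rewrite rowK scale_row_mx -!scalemxAr -!scalemxAl.
move: cL'; rewrite -row_mx0 => /eq_row_mx[v0 u0].
have KS := lincomb_SQFI (fun i => c 0 i) HS.
have Kp := det _ KS v0 u0; have [_ KD] := KS.
apply/rowP => i; rewrite mxE; apply: (iH (fun i => c 0 i)) => X Y.
by apply: Cinf_eqP => q; rewrite -[LHS]/(lincomb (fun i => c 0 i) H X Y q)
  (parallel_zero KD cM Kp).
Qed.

(** An independent family of the largest possible size is complete. *)
Lemma complete_set_exists N : (forall l (H : 'I_l -> tensor02 M),
    (forall i, SQFI D (H i)) -> independent H -> (l <= N)%N) ->
  exists l, is_index D l.
Proof.
move=> bound.
pose P l := `[< exists H : 'I_l -> tensor02 M, (forall i, SQFI D (H i)) /\ independent H >].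
have P0 : exists l, P l.
  by exists 0%N; apply/asboolP; exists (fun i : 'I_0 =>
    let: Ordinal _ i0 := i in False_rect _ (notF i0)); split=> [[]//|c _ []].
have PN l : P l -> (l <= N)%N by move=> /asboolP[H [H1 H2]]; exact: bound H1 H2.
have [l /asboolP[H [HS iH]] lmax] := ex_maxnP P0 PN.
exists l, H; split => // K KS.
apply: contrapT => noK.
suff /lmax : P l.+1 by rewrite ltnn.
apply/asboolP; exists (fun i => if unlift ord_max i is Some j then H j else K); split.
  by move=> i; case: unlift.
move=> c c0.
have liftE (i : 'I_l) : widen_ord (leqnSn l) i = lift ord_max i.
  by apply: val_inj; rewrite /= /bump leqNgt ltn_ord.
have sumE X Y : \sum_(i < l) c (lift ord_max i) *: H i X Y + c ord_max *: K X Y = 0.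
  rewrite -[RHS](c0 X Y) big_ord_recr /= unlift_none; congr (_ + _).
  by apply: eq_bigr => i _; rewrite liftE liftK.
have cK : c ord_max = 0.
  apply: contrapT => /eqP cK; apply: noK.
  exists (fun i => - (c (lift ord_max i) / c ord_max)) => X Y.
  apply: Cinf_eqP => p; apply: (mulfI cK).
  have := congr1 (fun f : Cinf M => f p) (sumE X Y).
  rewrite CinfD Cinf_sum CinfZ Cinf0 => /eqP; rewrite addrC addr_eq0 => /eqP ->.
  rewrite Cinf_sum mulr_sumr -sumrN; apply: eq_bigr => i _; rewrite !CinfZ.
  by field.
have cH := iH (fun i => c (lift ord_max i)).
move=> i; have [j ->|->//] := unliftP ord_max i.
by apply: cH => X Y; have := sumE X Y; rewrite cK scale0r addr0.
Qed.

End Index.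

Theorem theorem10 (R : realType) (n : nat) (M : smoothManifold R n)
  (g : semiRiemannianMetric M) (D : linearConnection M) (a b : R) :
  (2 < n)%N ->
  connected [set: M] ->
  metric_connection g D ->
  b != 0 ->
  quasi_conformally_symmetric g D a b ->
  ~ parallel2 D (einstein_tensor g D) ->
  (exists l : nat, is_index D l) /\
  (forall l : nat, is_index D l -> (1 <= l <= n + 1)%N).
Proof.
move=> n2 cM gD b0 qc nE.
have ab := quasi_conformally_symmetric_coef gD n2 qc nE.
have [U [X [Y [p Ep]]]] : exists U X Y p, cov_deriv2 D (einstein_tensor g D) U X Y p <> 0.
  apply: contrapT => H; apply: nE => U X Y; apply: Cinf_eqP => p.
  by apply: contrapT => Ep; apply: H; exists U, X, Y, p.
have [E [v [u [u' det]]]] := parallel_form_determined gD n2 b0 qc ab Ep.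
have bound l (H : 'I_l -> tensor02 M) :
    (forall i, SQFI D (H i)) -> independent H -> (l <= n + 1)%N.
  by move=> HS iH; exact: independent_bound cM HS iH det.
split; first exact: complete_set_exists bound.
move=> l [H [HS iH span]]; rewrite (bound l H HS iH) andbT lt0n.
apply/eqP => l0; subst l.
have gS : SQFI D g by split=> //; exact: Defs.metric_sym.
have [c gc] := span _ gS.
have g0 X' Y' : g X' Y' = 0 by rewrite gc big_ord0.
have [F [x fr]] := frame_exists p.
have := gram_unit g fr.
have -> : frame_mx F p g = 0 by apply/matrixP => k m; rewrite !mxE g0.
have n0 : (0 < n)%N := ltnW (ltnW n2).
move=> /mulVmx; rewrite mulmx0 => /matrixP/(_ (Ordinal n0) (Ordinal n0)).
by rewrite !mxE eqxx => /eqP; rewrite eq_sym oner_eq0.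
Qed.
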